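(* For every $s>0$ the approximation problem for the embeddings $$I_d:H^{s,\#}_{\rm mix}(\mathbb{T}^d)\to L_2(\mathbb{T}^d),\qquad d\in\mathbb{N},$$ is quasi-polynomially tractable.
   Context: $\mathbb{N}=\{1,2,3,\dots\}$. $\mathbb{T}^d$ is the $d$-torus, represented by $[0,2\pi]^d$ with opposite sides identified. $L_2(\mathbb{T}^d)$ carries the norm $\|f|L_2(\mathbb{T}^d)\|=(\int_{\mathbb{T}^d}|f(x)|^2dx)^{1/2}$, and for $f\in L_2(\mathbb{T}^d)$ the Fourier coefficients are $c_k(f)=(2\pi)^{-d/2}\int_{\mathbb{T}^d}f(x)e^{-ikx}dx$, $k\in\mathbb{Z}^d$ (so $\|f|L_2(\mathbb{T}^d)\|^2=\sum_k|c_k(f)|^2$). For $s>0$, $H^{s,\#}_{\rm mix}(\mathbb{T}^d)$ is the space of all $f\in L_2(\mathbb{T}^d)$ for which the norm $$\|f|H^s_{\rm mix}(\mathbb{T}^d)\|^{\#}=\Big[\sum_{k\in\mathbb{Z}^d}|c_k(f)|^2\prod_{j=1}^d(1+|k_j|)^{2s}\Big]^{1/2}$$ is finite, equipped with this norm. $I_d$ denotes the identical embedding $f\mapsto f$. The approximation numbers of a bounded linear operator $T:X\to Y$ between Banach spaces are $a_n(T:X\to Y)=\inf\{\|T-A:X\to Y\| : A:X\to Y \text{ bounded linear},\ {\rm rank}\,A<n\}$, $n\in\mathbb{N}$. The information complexity of the $d$-variate approximation problem is $n(\varepsilon,d):=\inf\{n\in\mathbb{N}: a_n(I_d)\le\varepsilon\}$.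 The approximation problem for the family $(I_d)_{d\in\mathbb{N}}$ is called quasi-polynomially tractable if there are positive numbers $t$ and $C_t$ (independent of $\varepsilon$ and $d$) such that $$n(\varepsilon,d)\le C_t\exp\big(t\,\ln(\varepsilon^{-1})(1+\ln d)\big)\qquad\text{for all }0<\varepsilon\le1\text{ and all }d\in\mathbb{N}.$$ *)

(* Defs.v *)
From HB Require Import structures.
From mathcomp Require Import all_boot all_order all_algebra generic_quotient ring_quotient.
From mathcomp Require Import complex.
From mathcomp Require Import all_classical all_reals all_analysis.
From mathcomp Require Import measurable_realfun.
From mathcomp Require Import ring lra.

Set Implicit Arguments.
Unset Strict Implicit.
Unset Printing Implicit Defensive.

Import Order.TTheory GRing.Theory Num.Theory.
Import numFieldNormedType.Exports.
Import Normc.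

Local Notation Re := complex.Re.
Local Notation Im := complex.Im.

Local Open Scope classical_set_scope.
Local Open Scope ring_scope.
Local Open Scope quotient_scope.

Section consing_measure.
Context {d} {T : measurableType d} {R : realType} {n : nat}.
Variables (m : {finite_measure set T -> \bar R}).
Variables (mu : {finite_measure set (n.-tuple T) -> \bar R}).
Local Open Scope ereal_scope.

(* Image of the product measure under (x, (y_1, .., y_n)) |-> (x, y_1, .., y_n),
   so that iterating it gives product measures on tuples. *)
Definition cons_measure : set (n.+1.-tuple T) -> \bar R :=
  pushforward (m \x mu) (fun x : T * n.-tuple T => [tuple of x.1 :: x.2]).

Let mcons : measurable_fun [set: T * n.-tuple T]
  (fun x : T * n.-tuple T => [tuple of x.1 :: x.2]).
Proof. exact: measurable_cons. Qed.

Let cons_measure0 : cons_measure set0 = 0.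
Proof. by rewrite /cons_measure /pushforward preimage_set0 measure0. Qed.

Let cons_measure_ge0 A : 0 <= cons_measure A.
Proof. exact: measure_ge0. Qed.

Let cons_measure_sigma_additive : semi_sigma_additive cons_measure.
Proof.
move=> F mF tF mUF; rewrite /cons_measure /pushforward preimage_bigcup.
apply: measure_semi_sigma_additive.
- by move=> k; rewrite -[X in measurable X]setTI; exact: mcons.
- apply/trivIsetP => /= i j _ _ ij; rewrite -preimage_setI.
  by move/trivIsetP : tF => /(_ _ _ _ _ ij) ->//; rewrite preimage_set0.
- by rewrite -preimage_bigcup -[X in measurable X]setTI; exact: mcons.
Qed.

HB.instance Definition _ := isMeasure.Build _ _ _ cons_measure
  cons_measure0 cons_measure_ge0 cons_measure_sigma_additive.

Let cons_measure_fin : fin_num_fun cons_measure.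
Proof.
apply: lty_fin_num_fun; rewrite /= /cons_measure /pushforward preimage_setT.
rewrite -setXTT product_measure1E// lte_mul_pinfty// ?fin_num_measure//.
by rewrite ltey_eq fin_num_measure.
Qed.

HB.instance Definition _ := Measure_isFinite.Build _ _ _ cons_measure
  cons_measure_fin.

End consing_measure.

Section torus.
Context {R : realType}.

Definition period : set (measurableTypeR R) := `[0, 2 * pi].

Lemma measurable_period : measurable period.
Proof. exact: measurable_itv. Qed.

Lemma period_lty : (@lebesgue_measure R period < +oo)%E.
Proof. by rewrite lebesgue_measure_itv /=; case: ifP => // _; rewrite -EFinD ltry. Qed.

(* Lebesgue measure of R^d restricted to [0, 2 pi]^d: identifying opposite sides
   of the cube only affects a null set, so L_2 of this measure is L_2(T^d). *)
Fixpoint torus_measure (d : nat) :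
    {finite_measure set (d.-tuple (measurableTypeR R)) -> \bar R} :=
  match d with
  | 0 => \d_ [tuple]
  | d'.+1 => cons_measure (mfrestr measurable_period period_lty)
                          (torus_measure d')
  end.
End torus.

Section complex_L2_functions.
Context {d} {T : measurableType d} {R : realType}.
Variable mu : {finite_measure set T -> \bar R}.
Implicit Types f g : T -> R[i].

Definition cmeasurable f :=
  measurable_fun setT (fun x => Re (f x)) /\
  measurable_fun setT (fun x => Im (f x)).

Definition cintegral f : R[i] :=
  ((\int[mu]_x Re (f x)) +i* (\int[mu]_x Im (f x)))%C.

Definition square_integrable f :=
  (\int[mu]_x (normc (f x) ^+ 2)%:E < +oo)%E.

Definition L2_pred : {pred T -> R[i]} :=
  [pred f | `[< cmeasurable f /\ square_integrable f >]].

Lemma sqr_normc_def (z : R[i]) : normc z ^+ 2 = Re z ^+ 2 + Im z ^+ 2.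
Proof. by case: z => a b /=; rewrite sqr_sqrtr// addr_ge0// sqr_ge0. Qed.

Lemma normc_ge0 (z : R[i]) : 0 <= normc z.
Proof. by case: z => a b /=; exact: sqrtr_ge0. Qed.

Lemma cmeasurable_sqr_normc f : cmeasurable f ->
  measurable_fun setT (fun x => normc (f x) ^+ 2).
Proof.
move=> [mr mi].
under eq_fun do rewrite sqr_normc_def.
by apply: measurable_funD; exact: measurable_funX.
Qed.

Lemma sqr_normc_axpy (a z w : R[i]) :
  normc (a * z + w) ^+ 2 <= 2 * normc a ^+ 2 * normc z ^+ 2 + 2 * normc w ^+ 2.
Proof.
rewrite -mulrA -exprMn -normcM; move: (a * z) => {}z.
rewrite !sqr_normc_def; case: z w => [z1 z2] [w1 w2] /=.
by have := sqr_ge0 (z1 - w1); have := sqr_ge0 (z2 - w2); nra.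
Qed.

Lemma cmeasurable_axpy (a : R[i]) f g :
  cmeasurable f -> cmeasurable g -> cmeasurable (fun x => a * f x + g x).
Proof.
move=> [mfr mfi] [mgr mgi]; split.
- rewrite (_ : (fun _ => _) =
    (fun x => Re a * Re (f x) - Im a * Im (f x) + Re (g x))).
    by apply: measurable_funD => //; apply: measurable_funB;
       apply: measurable_funM.
  by apply/funext => x; case: a (f x) (g x) => [? ?] [? ?] [].
- rewrite (_ : (fun _ => _) =
    (fun x => Re a * Im (f x) + Im a * Re (f x) + Im (g x))).
    by apply: measurable_funD => //; apply: measurable_funD;
       apply: measurable_funM.
  by apply/funext => x; case: a (f x) (g x) => [? ?] [? ?] [].
Qed.

Lemma square_integrable_axpy (a : R[i]) f g :
  cmeasurable f -> cmeasurable g ->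
  square_integrable f -> square_integrable g ->
  square_integrable (fun x => a * f x + g x).
Proof.
move=> mf mg f2 g2; rewrite /square_integrable.
pose F x := ((2 * normc a ^+ 2)%:E * (normc (f x) ^+ 2)%:E
             + 2%:E * (normc (g x) ^+ 2)%:E)%E.
have mF1 : measurable_fun setT (fun x => (normc (f x) ^+ 2)%:E).
  exact/measurable_EFinP/cmeasurable_sqr_normc.
have mG1 : measurable_fun setT (fun x => (normc (g x) ^+ 2)%:E).
  exact/measurable_EFinP/cmeasurable_sqr_normc.
have a0 : 0 <= 2 * normc a ^+ 2 by rewrite mulr_ge0 ?sqr_ge0.
apply: (@le_lt_trans _ _ (\int[mu]_x F x)%E).
  apply: ge0_le_integral => //.
  - by move=> x _; rewrite lee_fin sqr_ge0.
  - apply/measurable_EFinP/cmeasurable_sqr_normc; exact: cmeasurable_axpy.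
  - by apply: emeasurable_funD; apply: measurable_funeM.
  - by move=> x _; rewrite /F -!EFinM -EFinD lee_fin sqr_normc_axpy.
rewrite /F ge0_integralD//=; first last.
- exact: measurable_funeM.
- by move=> x _; rewrite mule_ge0// lee_fin ?sqr_ge0.
- exact: measurable_funeM.
- by move=> x _; rewrite mule_ge0// lee_fin ?sqr_ge0.
rewrite !ge0_integralZl//; try by move=> x _; rewrite lee_fin sqr_ge0.
by rewrite lte_add_pinfty// lte_mul_pinfty.
Qed.

Lemma L2_submod_closed : submod_closed L2_pred.
Proof.
split.
  apply/asboolP; split; first by split; exact: measurable_cst.
  rewrite /square_integrable (_ : (fun _ => _) = cst 0%E) ?integral0//.
  by apply/funext => x /=; rewrite expr0n addr0 sqrtr0 expr0n.
move=> a f g /asboolP[mf f2] /asboolP[mg g2]; apply/asboolP; split.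
  exact: cmeasurable_axpy.
exact: square_integrable_axpy.
Qed.

HB.instance Definition _ :=
  GRing.isSubmodClosed.Build R[i] (T -> R[i]) L2_pred L2_submod_closed.

Record L2fun := MkL2fun { L2fun_val :> T -> R[i] ; _ : L2fun_val \in L2_pred }.
HB.instance Definition _ := [isSub for L2fun_val].
HB.instance Definition _ := [Choice of L2fun by <:].
HB.instance Definition _ := [SubChoice_isSubLmodule of L2fun by <:].

Definition ae_null : {pred L2fun} :=
  [pred f : L2fun | `[< \forall x \ae mu, (f : T -> R[i]) x = 0 >]].

Lemma ae_null_closed : zmod_closed ae_null.
Proof.
split; first by apply/asboolP; exact: nearW.
move=> f g /asboolP f0 /asboolP g0; apply/asboolP.
apply: filterS2 f0 g0 => x fx gx.
by rewrite -[LHS]/(f x - g x) fx gx subrr.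
Qed.

HB.instance Definition _ :=
  GRing.isZmodClosed.Build L2fun ae_null ae_null_closed.

(* Square-integrable functions modulo equality almost everywhere; the scalar
   field is C. *)
Definition L2space := Quotient.quot ae_null.
HB.instance Definition _ := GRing.Zmodule.on L2space.
HB.instance Definition _ := EqQuotient.on L2space.

Definition L2_class (f : L2fun) : L2space := \pi_L2space f.

Lemma L2_classK (f : L2space) : L2_class (repr f) = f.
Proof. exact: reprK. Qed.

Lemma eq_L2P (f g : L2fun) :
  L2_class f = L2_class g <-> \forall x \ae mu, f x = g x.
Proof.
split.
  move/eqP; rewrite -Quotient.idealrBE => /asboolP; apply: filterS => x.
  by rewrite -[LHS]/(f x - g x) => /subr0_eq.
move=> fg; apply/eqP; rewrite -Quotient.idealrBE; apply/asboolP.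
by apply: filterS fg => x fgx; rewrite -[LHS]/(f x - g x) fgx subrr.
Qed.

Definition L2_scale (a : R[i]) (f : L2space) : L2space :=
  L2_class (a *: repr f).

Lemma pi_L2_scale a (f : L2fun) :
  L2_scale a (L2_class f) = L2_class (a *: f).
Proof.
apply/eq_L2P; have /eq_L2P : L2_class (repr (L2_class f)) = L2_class f.
  by rewrite L2_classK.
apply: filterS => x fx.
by rewrite -[LHS]/(a * repr (L2_class f) x) fx.
Qed.

Lemma pi_L2D (f g : L2fun) :
  L2_class f + L2_class g = L2_class (f + g).
Proof. by rewrite /L2_class raddfD. Qed.

Let L2_scaleA a b (f : L2space) : L2_scale a (L2_scale b f) = L2_scale (a * b) f.
Proof. by rewrite -[f]L2_classK !pi_L2_scale scalerA. Qed.

Let L2_scale1 : left_id 1 L2_scale.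
Proof. by move=> f; rewrite -[f]L2_classK pi_L2_scale scale1r. Qed.

Let L2_scaleDr : right_distributive L2_scale +%R.
Proof.
move=> a f g; rewrite -[f]L2_classK -[g]L2_classK.
by rewrite pi_L2D !pi_L2_scale pi_L2D scalerDr.
Qed.

Let L2_scaleDl (f : L2space) : {morph L2_scale^~ f : a b / a + b}.
Proof.
by move=> a b; rewrite -[f]L2_classK !pi_L2_scale pi_L2D scalerDl.
Qed.

HB.instance Definition _ := GRing.Zmodule_isLmodule.Build R[i] L2space
  L2_scaleA L2_scale1 L2_scaleDr L2_scaleDl.

Definition L2_norm (f : L2space) : R :=
  Num.sqrt (\int[mu]_x (normc (repr f x) ^+ 2)).

Lemma L2funP (f : L2fun) : cmeasurable f /\ square_integrable f.
Proof. by apply/asboolP; exact: (valP f). Qed.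

Lemma repr_pi_L2 (f : L2fun) :
  \forall x \ae mu, repr (L2_class f) x = f x.
Proof. by apply/eq_L2P; rewrite L2_classK. Qed.

Lemma L2_normE (f : L2fun) :
  L2_norm (L2_class f) = Num.sqrt (\int[mu]_x (normc (f x) ^+ 2)).
Proof.
congr (Num.sqrt (fine _)); apply: ae_eq_integral => //.
- by apply/measurable_EFinP/cmeasurable_sqr_normc; have [] := L2funP (repr (L2_class f)).
- by apply/measurable_EFinP/cmeasurable_sqr_normc; have [] := L2funP f.
- by apply: filterS (repr_pi_L2 f) => x -> _.
Qed.

Lemma integrable_Re f : cmeasurable f -> square_integrable f ->
  mu.-integrable setT (EFin \o (fun x => Re (f x))).
Proof.
move=> mf f2; pose h x := ((1 + normc (f x) ^+ 2)%:E : \bar R).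
apply: (@le_integrable _ _ _ _ _ _ _ h) => //.
- by apply/measurable_EFinP; case: mf.
- move=> x _; rewrite /= lee_fin [leRHS]ger0_norm ?addr_ge0 ?sqr_ge0//.
  rewrite sqr_normc_def ler_norml; apply/andP.
  by have := sqr_ge0 (Re (f x) + 1); have := sqr_ge0 (Re (f x) - 1);
     have := sqr_ge0 (Im (f x)); split; nra.
- rewrite (_ : h = (EFin \o cst 1) \+ (fun x => (normc (f x) ^+ 2)%:E))//.
  apply: integrableD => //; first exact: finite_measure_integrable_cst.
  apply/integrableP; split.
    exact/measurable_EFinP/cmeasurable_sqr_normc.
  by under eq_integral do rewrite gee0_abs ?lee_fin ?sqr_ge0//.
Qed.

Lemma integrable_Im f : cmeasurable f -> square_integrable f ->
  mu.-integrable setT (EFin \o (fun x => Im (f x))).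
Proof.
move=> mf f2; pose h x := ((1 + normc (f x) ^+ 2)%:E : \bar R).
apply: (@le_integrable _ _ _ _ _ _ _ h) => //.
- by apply/measurable_EFinP; case: mf.
- move=> x _; rewrite /= lee_fin [leRHS]ger0_norm ?addr_ge0 ?sqr_ge0//.
  rewrite sqr_normc_def ler_norml; apply/andP.
  by have := sqr_ge0 (Im (f x) + 1); have := sqr_ge0 (Im (f x) - 1);
     have := sqr_ge0 (Re (f x)); split; nra.
- rewrite (_ : h = (EFin \o cst 1) \+ (fun x => (normc (f x) ^+ 2)%:E))//.
  apply: integrableD => //; first exact: finite_measure_integrable_cst.
  apply/integrableP; split.
    exact/measurable_EFinP/cmeasurable_sqr_normc.
  by under eq_integral do rewrite gee0_abs ?lee_fin ?sqr_ge0//.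
Qed.

Lemma Rintegral_lin2 (a b : R) (u v w : T -> R) :
  mu.-integrable setT (EFin \o u) -> mu.-integrable setT (EFin \o v) ->
  mu.-integrable setT (EFin \o w) ->
  \int[mu]_x (a * u x + b * v x + w x) =
  a * \int[mu]_x u x + b * \int[mu]_x v x + \int[mu]_x w x.
Proof.
move=> iu iv iw.
have iau : mu.-integrable setT (EFin \o (fun x => a * u x)).
  exact: (integrableZl measurableT a iu).
have ibv : mu.-integrable setT (EFin \o (fun x => b * v x)).
  exact: (integrableZl measurableT b iv).
rewrite RintegralD//; last exact: (integrableD measurableT iau ibv).
by rewrite RintegralD// !RintegralZl.
Qed.

Lemma cintegral_axpy (a : R[i]) f g :
  cmeasurable f -> square_integrable f ->
  cmeasurable g -> square_integrable g ->
  cintegral (fun x => a * f x + g x) = a * cintegral f + cintegral g.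
Proof.
move=> mf f2 mg g2; rewrite /cintegral.
have iRf := integrable_Re mf f2; have iIf := integrable_Im mf f2.
have iRg := integrable_Re mg g2; have iIg := integrable_Im mg g2.
have -> : \int[mu]_x Re (a * f x + g x) = Re a * \int[mu]_x Re (f x)
   + (- Im a) * \int[mu]_x Im (f x) + \int[mu]_x Re (g x).
  rewrite -Rintegral_lin2//; apply: eq_Rintegral => x _.
  by case: a (f x) (g x) => [? ?] [? ?] [? ?] /=; rewrite mulNr.
have -> : \int[mu]_x Im (a * f x + g x) = Re a * \int[mu]_x Im (f x)
   + Im a * \int[mu]_x Re (f x) + \int[mu]_x Im (g x).
  rewrite -Rintegral_lin2//; apply: eq_Rintegral => x _.
  by case: a (f x) (g x) => [? ?] [? ?] [? ?] /=.
apply/eqP; rewrite eq_complex; case: a => a b /=.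
by rewrite mulNr !eqxx.
Qed.

Lemma ae_eq_cintegral f g : cmeasurable f -> cmeasurable g ->
  (\forall x \ae mu, f x = g x) -> cintegral f = cintegral g.
Proof.
move=> [mfr mfi] [mgr mgi] fg; congr Complex; congr fine.
- apply: ae_eq_integral => //; try exact/measurable_EFinP.
  by apply: filterS fg => x -> _.
- apply: ae_eq_integral => //; try exact/measurable_EFinP.
  by apply: filterS fg => x -> _.
Qed.

End complex_L2_functions.

Lemma ge0_esumZl_le (R : realType) (I : choiceType) (c : R) (a : I -> R) :
  0 <= c -> (forall i, 0 <= a i) ->
  (\esum_(i in [set: I]) (c%:E * (a i)%:E) <=
   c%:E * \esum_(i in [set: I]) (a i)%:E)%E.
Proof.
move=> c0 a0; apply: ub_ereal_sup => _ [A [finA _]] <-.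
rewrite -ge0_mule_fsumr; last by move=> i; rewrite lee_fin.
by rewrite lee_wpmul2l ?lee_fin//; apply: esum_ge; exists A.
Qed.

Section fourier.
Context {R : realType} {d : nat}.
Local Notation X := (d.-tuple (measurableTypeR R)).
Local Notation mu := (@torus_measure R d).
Implicit Types (k : d.-tuple int) (f g : X -> R[i]).

Local Notation L2_torus := (L2space mu).

Definition kdot k (x : X) : R :=
  \sum_(j < d) (tnth k j)%:~R * (tnth x j : R).

(* e^{it} *)
Definition cis (t : R) : R[i] := (cos t +i* sin t)%C.

Definition fourier_coef_fun k f : R[i] :=
  ((2 * pi) `^ (- (d%:R / 2)))%:C%C *
  cintegral mu (fun x => f x * cis (- kdot k x)).

Definition fourier_coef k (f : L2_torus) : R[i] :=
  fourier_coef_fun k (repr f).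

Lemma normc_cis t : normc (cis t) = 1.
Proof. by rewrite /cis /= cos2Dsin2 sqrtr1. Qed.

Lemma measurable_kdot k : measurable_fun setT (kdot k).
Proof.
rewrite /kdot; elim: (index_enum _) => [|j r ih].
  by under eq_fun do rewrite big_nil; exact: measurable_cst.
under eq_fun do rewrite big_cons.
by apply: measurable_funD => //; apply: measurable_funM => //;
  exact: measurable_tnth.
Qed.

Lemma cmeasurable_mul_cis k f : cmeasurable f ->
  cmeasurable (fun x => f x * cis (- kdot k x)).
Proof.
move=> [mr mi].
have mc : measurable_fun setT (fun x => cos (- kdot k x)).
  apply: measurableT_comp; last by apply: measurable_funN; exact: measurable_kdot.
  by apply: continuous_measurable_fun; exact: continuous_cos.
have ms : measurable_fun setT (fun x => sin (- kdot k x)).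
  apply: measurableT_comp; last by apply: measurable_funN; exact: measurable_kdot.
  by apply: continuous_measurable_fun; exact: continuous_sin.
split.
- rewrite (_ : (fun _ => _) = (fun x => Re (f x) * cos (- kdot k x)
                               - Im (f x) * sin (- kdot k x))).
    by apply: measurable_funB; exact: measurable_funM.
  by apply/funext => x; case: (f x).
- rewrite (_ : (fun _ => _) = (fun x => Re (f x) * sin (- kdot k x)
                               + Im (f x) * cos (- kdot k x))).
    by apply: measurable_funD; exact: measurable_funM.
  by apply/funext => x; case: (f x).
Qed.

Lemma square_integrable_mul_cis k f : square_integrable mu f ->
  square_integrable mu (fun x => f x * cis (- kdot k x)).
Proof.
move=> f2; rewrite /square_integrable.
rewrite (eq_integral (fun x => (normc (f x) ^+ 2)%:E))// => x _.
by rewrite normcM normc_cis mulr1.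
Qed.

Lemma fourier_coefE k (f : L2fun mu) :
  fourier_coef k (L2_class f) = fourier_coef_fun k f.
Proof.
congr (_ * _); apply: ae_eq_cintegral.
- by apply: cmeasurable_mul_cis; case: (L2funP (repr (L2_class f))).
- by apply: cmeasurable_mul_cis; case: (L2funP f).
- by apply: filterS (repr_pi_L2 f) => x ->.
Qed.

Lemma fourier_coef_is_linear k : linear (fourier_coef k : L2_torus -> R[i]^o).
Proof.
move=> a f g; rewrite -[f]L2_classK -[g]L2_classK.
have -> : a *: L2_class (repr f) + L2_class (repr g) =
          L2_class (a *: repr f + repr g).
  rewrite -[a *: _]/(L2_scale _ _) pi_L2_scale; exact: pi_L2D.
rewrite !fourier_coefE /fourier_coef_fun.
rewrite -[RHS]/(a * (_ * _) + _) mulrCA -mulrDr; congr (_ * _).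
have [mf f2] := L2funP (repr f); have [mg g2] := L2funP (repr g).
rewrite -cintegral_axpy; first last.
- exact: square_integrable_mul_cis.
- exact: cmeasurable_mul_cis.
- exact: square_integrable_mul_cis.
- exact: cmeasurable_mul_cis.
by congr cintegral; apply/funext => x; rewrite mulrA -mulrDl.
Qed.

Variable s : R.

Definition mix_weight k : R :=
  \prod_(j < d) (1 + `|tnth k j|%:~R) `^ (2 * s).

(* Square of the norm, in [0, +oo]. *)
Definition mix_sqr (f : L2_torus) : \bar R :=
  \esum_(k in [set: d.-tuple int])
    (normc (fourier_coef k f) ^+ 2 * mix_weight k)%:E.

Definition Hmix_pred : {pred L2_torus} :=
  [pred f : L2_torus | `[< (mix_sqr f < +oo)%E >]].

Lemma mix_weight_ge0 k : 0 <= mix_weight k.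
Proof. by apply: prodr_ge0 => j _; exact: powR_ge0. Qed.

Lemma Hmix_submod_closed : submod_closed Hmix_pred.
Proof.
have lin k := fourier_coef_is_linear k.
split.
  apply/asboolP; rewrite /mix_sqr esum1// => k _.
  have := lin k (-1) 0 0; rewrite !scaleN1r !addNr => ->.
  by rewrite normc0 expr0n mul0r.
move=> a f g /asboolP Hf /asboolP Hg; apply/asboolP.
pose A := 2 * normc a ^+ 2.
have A0 : 0 <= A by rewrite mulr_ge0 ?sqr_ge0.
pose F k := (A%:E * (normc (fourier_coef k f) ^+ 2 * mix_weight k)%:E)%E.
pose G k := (2%:E * (normc (fourier_coef k g) ^+ 2 * mix_weight k)%:E)%E.
have F0 k : (0 <= F k)%E.
  by rewrite mule_ge0// lee_fin mulr_ge0 ?sqr_ge0 ?mix_weight_ge0.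
have G0 k : (0 <= G k)%E.
  by rewrite mule_ge0// lee_fin mulr_ge0 ?sqr_ge0 ?mix_weight_ge0.
apply: (@le_lt_trans _ _
    (\esum_(k in [set: d.-tuple int]) (F k + G k))%E).
  apply: le_esum => k _; rewrite /F /G -!EFinM -EFinD lee_fin.
  rewrite lin (mulrA A) (mulrA 2) -mulrDl ler_wpM2r ?mix_weight_ge0//.
  exact: (sqr_normc_axpy a (fourier_coef k f) (fourier_coef k g)).
rewrite esumD//; apply: lte_add_pinfty.
- apply: le_lt_trans; first apply: ge0_esumZl_le => // k.
    by rewrite mulr_ge0 ?sqr_ge0 ?mix_weight_ge0.
  by apply: lte_mul_pinfty; [rewrite lee_fin | rewrite fin_numE | exact: Hf].
- apply: le_lt_trans; first apply: ge0_esumZl_le => // k.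
    by rewrite mulr_ge0 ?sqr_ge0 ?mix_weight_ge0.
  by apply: lte_mul_pinfty; [rewrite lee_fin | rewrite fin_numE | exact: Hg].
Qed.

HB.instance Definition _ :=
  GRing.isSubmodClosed.Build R[i] L2_torus Hmix_pred Hmix_submod_closed.

Record Hmix := MkHmix { Hmix_val :> L2_torus ; _ : Hmix_val \in Hmix_pred }.
HB.instance Definition _ := [isSub for Hmix_val].
HB.instance Definition _ := [Choice of Hmix by <:].
HB.instance Definition _ := [SubChoice_isSubLmodule of Hmix by <:].

Definition Hmix_norm (f : Hmix) : R := Num.sqrt (fine (mix_sqr f)).

Definition Hmix_embedding : {linear Hmix -> L2_torus} := \val.

End fourier.

Section approximation_numbers.
Context {R : realType} {X Y : lmodType R[i]}.
Variables (normX : X -> R) (normY : Y -> R).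

(* The norms are explicit arguments: only their values enter the definitions
   below. *)
Definition operator_norm (A : X -> Y) : \bar R :=
  ereal_sup [set (normY (A x))%:E | x in [set x | normX x <= 1]].

Definition bounded_operator (A : X -> Y) :=
  exists M : R, forall x, normY (A x) <= M * normX x.

Definition linearly_independent m (b : 'I_m -> Y) :=
  forall c : 'I_m -> R[i], \sum_(i < m) c i *: b i = 0 -> forall i, c i = 0.

(* The range has a basis of m vectors. *)
Definition has_rank (A : X -> Y) m :=
  exists b : 'I_m -> Y, linearly_independent b /\
    range A = [set y | exists c : 'I_m -> R[i], y = \sum_(i < m) c i *: b i].

Definition approximation_number (n : nat) (S : X -> Y) : \bar R :=
  ereal_inf [set operator_norm (fun x => S x - A x) | A in
    [set A : {linear X -> Y} |
      bounded_operator A /\ exists2 m, (m < n)%N & has_rank A m]].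

(* Equal to +oo when no n qualifies. *)
Definition information_complexity (S : X -> Y) (eps : R) : \bar R :=
  ereal_inf [set n%:R%:E | n in
    [set n : nat | (0 < n)%N /\ (approximation_number n S <= eps%:E)%E]].

End approximation_numbers.

Definition quasi_polynomially_tractable {R : realType}
    (n : R -> nat -> \bar R) :=
  exists t C : R, 0 < t /\ 0 < C /\
    forall (eps : R) (d : nat), 0 < eps <= 1 -> (0 < d)%N ->
      (n eps d <= (C * expR (t * ln eps^-1 * (1 + ln d%:R)))%:E)%E.

(* Main.v *)
(* Truncating the Fourier series of f to the hyperbolic cross
   {k : prod_j (1 + |k_j|) < eps^(-1/s)} is a linear operator whose rank is the
   size of the cross and whose error is at most eps on the unit ball, because
   every discarded coefficient is damped by a weight at least eps^-2. This needs
   that the L_2 norm is controlled by the Fourier coefficients alone, i.e. that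
   trigonometric polynomials are dense in L_2 of the torus. Density is obtained
   by a functional monotone class argument: the bounded functions in the L_2
   closure of an algebra of bounded functions are closed under products and
   bounded pointwise limits, so the sets whose indicator lies in that closure
   form a sigma-algebra containing every {f > 0} with f in the algebra; up to
   null sets, {x_i < a} is {cos (x_i - a/2) > cos (a/2)}.
   The cross is counted by Rankin's trick with an exponent depending on d: its
   size is at most X^p (sum_k (1 + |k|)^-p)^d with X = eps^(-1/s), and for
   p = 2 + ceil (log2 d) the inner sum is at most 1 + 2/d, whence the bound
   e^2 X^p. *)
Require Import Defs.
From HB Require Import structures.
From mathcomp Require Import all_boot all_order all_algebra complex.
From mathcomp Require Import all_classical all_reals all_analysis.
From mathcomp Require Import measurable_realfun ring lra zify.

Set Implicit Arguments.
Unset Strict Implicit.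
Unset Printing Implicit Defensive.

Import Order.TTheory GRing.Theory Num.Theory.
Import numFieldNormedType.Exports.
Import Normc.

Local Notation Re := complex.Re.
Local Notation Im := complex.Im.

Local Open Scope classical_set_scope.
Local Open Scope ring_scope.

(** * The L_2 closure of an algebra of bounded functions *)

(** The functions are real because the argument works with the sets {f > 0}; complex functions are
    later approximated through their real and imaginary parts. *)
Record bounded_algebra d (T : measurableType d) (R : realType)
    (P : set (T -> R)) : Prop := BoundedAlgebra {
  algebra_measurable : forall p, P p -> measurable_fun setT p;
  algebra_bounded : forall p, P p -> exists M, forall x, `|p x| <= M;
  algebra_cst : forall c, P (cst c);
  algebraD : forall p q, P p -> P q -> P (p \+ q);
  algebraM : forall p q, P p -> P q -> P (p \* q) }.

Section L2_closure.
Context d (T : measurableType d) (R : realType).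
Context (mu : {finite_measure set T -> \bar R}) (P : set (T -> R)).
Hypothesis algP : bounded_algebra P.
Implicit Types (f g h p q : T -> R).

Definition sqdist f g : \bar R := (\int[mu]_x ((f x - g x) ^+ 2)%:E)%E.

Definition approximable f := measurable_fun setT f /\
  forall e : R, 0 < e -> exists2 p, P p & (sqdist f p <= e%:E)%E.

Definition bounded_approximable f :=
  approximable f /\ exists M, forall x, `|f x| <= M.

Lemma measurable_sqB f g : measurable_fun setT f -> measurable_fun setT g ->
  measurable_fun setT (fun x => ((f x - g x) ^+ 2)%:E : \bar R).
Proof.
move=> mf mg; apply/measurable_EFinP; apply: measurable_funX.
exact: measurable_funB.
Qed.

(** Reduces the closure of [approximable] under limits, sums, multiples and products to pointwise
    inequalities between squares. *)
Lemma sqdist_le2 (a b : R) f f' g g' h h' : 0 <= a -> 0 <= b ->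
  measurable_fun setT f -> measurable_fun setT f' ->
  measurable_fun setT g -> measurable_fun setT g' ->
  measurable_fun setT h -> measurable_fun setT h' ->
  (forall x, (f x - f' x) ^+ 2 <= a * (g x - g' x) ^+ 2 + b * (h x - h' x) ^+ 2) ->
  (sqdist f f' <= a%:E * sqdist g g' + b%:E * sqdist h h')%E.
Proof.
move=> a0 b0 mf mf' mg mg' mh mh' ineq; rewrite /sqdist.
have sq0 (u v : T -> R) x : (0 <= ((u x - v x) ^+ 2)%:E)%E by rewrite lee_fin sqr_ge0.
rewrite -!ge0_integralZl//; try exact: measurable_sqB.
rewrite -ge0_integralD//; first last.
- by apply: measurable_funeM; exact: measurable_sqB.
- by move=> x _; rewrite mule_ge0.
- by apply: measurable_funeM; exact: measurable_sqB.
- by move=> x _; rewrite mule_ge0.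
apply: ge0_le_integral => //.
- exact: measurable_sqB.
- by apply: emeasurable_funD; apply: measurable_funeM; exact: measurable_sqB.
- by move=> x _; rewrite -!EFinM -EFinD lee_fin.
Qed.

Lemma sqdistxx f : sqdist f f = 0%E.
Proof.
by rewrite /sqdist (eq_integral (cst 0%E)) ?integral0// => x _; rewrite subrr expr0n.
Qed.

Lemma approximable_alg p : P p -> approximable p.
Proof.
move=> Pp; split; first exact: (algebra_measurable algP).
by move=> e e0; exists p => //; rewrite sqdistxx lee_fin ltW.
Qed.

Lemma bounded_approximable_alg p : P p -> bounded_approximable p.
Proof.
by move=> Pp; split; [exact: approximable_alg|exact: (algebra_bounded algP)].
Qed.

Lemma approximable_limit f (f_ : nat -> T -> R) : measurable_fun setT f ->
  (forall n, approximable (f_ n)) ->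
  ((fun n => sqdist f (f_ n)) @ \oo --> 0%E) -> approximable f.
Proof.
move=> mf af f_f; split => // e e0.
(* Quarters, because (u + v)^2 <= 2 u^2 + 2 v^2 doubles each of the two squared errors. *)
have e4 : 0 < e / 4 by lra.
have : \forall n \near \oo, (sqdist f (f_ n) < (e / 4)%:E)%E.
  have /fine_cvgP[fin fc] := f_f.
  near=> n; rewrite -[sqdist _ _]fineK; last by near: n.
  by rewrite lte_fin; near: n; exact: (cvgr_lt 0).
move=> [N _ /(_ N (leqnn N)) fN].
have [p Pp pe] := (af N).2 _ e4.
exists p => //.
have mp := algebra_measurable algP Pp; have mfN := (af N).1.
apply: le_trans (@sqdist_le2 2 2 f p f (f_ N) (f_ N) p _ _ _ _ _ _ _ _ _) _ => //.
  by move=> x; have := sqr_ge0 (f x - f_ N x - (f_ N x - p x)); nra.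
apply: (@le_trans _ _ (2%:E * (e / 4)%:E + 2%:E * (e / 4)%:E)%E).
  by apply: leeD; apply: lee_wpmul2l => //; rewrite ?lee_fin// ltW.
by rewrite -!EFinM -EFinD lee_fin; lra.
Unshelve. all: by end_near. Qed.

Lemma approximableD f g : approximable f -> approximable g ->
  approximable (f \+ g).
Proof.
move=> [mf af] [mg ag]; split; first exact: measurable_funD.
move=> e e0; have e4 : 0 < e / 4 by lra.
have [p Pp pe] := af _ e4; have [q Pq qe] := ag _ e4.
have mp := algebra_measurable algP Pp; have mq := algebra_measurable algP Pq.
exists (p \+ q); first exact: (algebraD algP).
apply: le_trans (@sqdist_le2 2 2 _ _ f p g q _ _ _ _ _ _ _ _ _) _ => //.
- exact: measurable_funD.
- exact: measurable_funD.
- by move=> x; have := sqr_ge0 (f x - p x - (g x - q x)); rewrite /=; nra.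
apply: (@le_trans _ _ (2%:E * (e / 4)%:E + 2%:E * (e / 4)%:E)%E).
  by apply: leeD; apply: lee_wpmul2l => //; rewrite ?lee_fin.
by rewrite -!EFinM -EFinD lee_fin; lra.
Qed.

Lemma approximableZ c f : approximable f -> approximable (fun x => c * f x).
Proof.
move=> [mf af]; split; first exact: measurable_funM.
(* The added 1 keeps the divisor positive at c = 0; the factor 2 appears because [sqdist_le2] is
   applied with the pair f, p in both terms. *)
move=> e e0; have c0 : 0 < 2 * (c ^+ 2 + 1) by have := sqr_ge0 c; lra.
have [p Pp pe] := af _ (divr_gt0 e0 c0).
have mp := algebra_measurable algP Pp.
exists (cst c \* p); first exact: (algebraM algP (algebra_cst algP c)).
apply: le_trans (@sqdist_le2 (c ^+ 2 + 1) (c ^+ 2 + 1) _ _ f p f p _ _ _ _ _ _ _ _ _) _ => //.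
- by have := sqr_ge0 c; lra.
- by have := sqr_ge0 c; lra.
- exact: measurable_funM.
- exact: measurable_funM.
- move=> x /=; rewrite -mulrBr exprMn.
  by have := sqr_ge0 (f x - p x); have := sqr_ge0 c; nra.
have c1 : 0 <= c ^+ 2 + 1 by have := sqr_ge0 c; lra.
rewrite -ge0_muleDl ?lee_fin//.
rewrite -EFinD -mulr2n -mulr_natl.
apply: (@le_trans _ _ ((2 * (c ^+ 2 + 1))%:E * (e / (2 * (c ^+ 2 + 1)))%:E)%E).
  by apply: lee_wpmul2l => //; rewrite lee_fin ltW.
by rewrite -EFinM mulrC divfK ?gt_eqF.
Qed.

(** In f g - p q = f (g - q) + q (f - p) a bound on q is known only once q is fixed. Hence q is
    chosen first, and the accuracy asked of p depends on the bound of q. *)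
Lemma bounded_approximableM f g : bounded_approximable f ->
  bounded_approximable g -> bounded_approximable (f \* g).
Proof.
move=> [[mf af] [F bf]] [[mg ag] [G bg]]; split; last first.
  exists (F * G) => x /=; rewrite normrM; apply: ler_pM => //.
split; first exact: measurable_funM.
move=> e e0.
have F0 : 0 < 4 * (F ^+ 2 + 1) by have := sqr_ge0 F; lra.
have [q Pq qe] := ag _ (divr_gt0 e0 F0).
have [Q bq] := algebra_bounded algP Pq.
have Q0 : 0 < 4 * (Q ^+ 2 + 1) by have := sqr_ge0 Q; lra.
have [p Pp pe] := af _ (divr_gt0 e0 Q0).
have mp := algebra_measurable algP Pp; have mq := algebra_measurable algP Pq.
exists (p \* q); first exact: (algebraM algP).
apply: le_trans (@sqdist_le2 (2 * (F ^+ 2 + 1)) (2 * (Q ^+ 2 + 1)) _ _ g q f p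
  _ _ _ _ _ _ _ _ _) _ => //.
- by lra.
- by lra.
- exact: measurable_funM.
- exact: measurable_funM.
- move=> x /=.
  have fF : f x ^+ 2 <= F ^+ 2.
    by rewrite -real_normK ?num_real// lerXn2r ?nnegrE// (le_trans _ (bf x)).
  have qQ : q x ^+ 2 <= Q ^+ 2.
    by rewrite -real_normK ?num_real// lerXn2r ?nnegrE// (le_trans _ (bq x)).
  have -> : f x * g x - p x * q x = f x * (g x - q x) + q x * (f x - p x) by ring.
  have := sqr_ge0 (f x * (g x - q x) - q x * (f x - p x)).
  have : 0 <= (F ^+ 2 + 1 - f x ^+ 2) * (g x - q x) ^+ 2.
    by rewrite mulr_ge0 ?sqr_ge0//; lra.
  have : 0 <= (Q ^+ 2 + 1 - q x ^+ 2) * (f x - p x) ^+ 2.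
    by rewrite mulr_ge0 ?sqr_ge0//; lra.
  move: (g x - q x) (f x - p x) => a b; nra.
apply: (@le_trans _ _ ((2 * (F ^+ 2 + 1))%:E * (e / (4 * (F ^+ 2 + 1)))%:E +
   (2 * (Q ^+ 2 + 1))%:E * (e / (4 * (Q ^+ 2 + 1)))%:E)%E).
  by apply: leeD; apply: lee_wpmul2l => //; rewrite lee_fin; lra.
rewrite -!EFinM -EFinD lee_fin.
have dbl (c : R) : 0 < 4 * c -> 2 * c * (e / (4 * c)) = e / 2.
  by move=> c0; field; rewrite ?gt_eqF//; lra.
by rewrite !dbl//; lra.
Qed.

Lemma bounded_approximableD f g : bounded_approximable f ->
  bounded_approximable g -> bounded_approximable (f \+ g).
Proof.
move=> [af [F bf]] [ag [G bg]]; split; first exact: approximableD.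
by exists (F + G) => x; apply: le_trans (ler_normD _ _) _; apply: lerD.
Qed.

Lemma bounded_approximable_cst c : bounded_approximable (cst c).
Proof. exact/bounded_approximable_alg/(algebra_cst algP). Qed.

Lemma bounded_approximableZ c f : bounded_approximable f ->
  bounded_approximable (fun x => c * f x).
Proof.
move=> bf; exact: (bounded_approximableM (bounded_approximable_cst c) bf).
Qed.

(** Since |f - f_n| <= 2 G, dominated convergence with majorant 4 G^2 turns pointwise convergence
    into L_2 convergence. The majorant may vary with x so that unbounded limits are covered in
    [approximable_ge0]. *)
Lemma approximable_cvg f (f_ : nat -> T -> R) (G : T -> R) :
  measurable_fun setT G -> (\int[mu]_x (G x ^+ 2)%:E < +oo)%E ->
  (forall n, approximable (f_ n)) ->
  (forall n x, `|f_ n x| <= G x) ->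
  (forall x, f_ ^~ x @ \oo --> f x) -> approximable f.
Proof.
move=> mG G2 af_ f_G f_f.
have mf_ n := (af_ n).1.
have mf : measurable_fun setT f.
  by apply: (measurable_fun_cvg mf_) => x _; exact: f_f.
have fG x : `|f x| <= G x.
  have cn : (fun n => `|f_ n x|) @ \oo --> `|f x| by apply: cvg_norm; exact: f_f.
  rewrite -(cvg_lim _ cn)//; apply: limr_le; first by apply/cvg_ex; exists `|f x|.
  by apply: nearW => n; exact: f_G.
apply: (approximable_limit mf af_).
have [] := @dominated_convergence _ T R mu setT measurableT
  (fun n x => ((f x - f_ n x) ^+ 2)%:E) (cst 0%E) (fun x => (4 * G x ^+ 2)%:E).
- by move=> n; apply: measurable_sqB.
- exact: measurable_cst.
- apply: aeW => x _; apply: cvg_EFin; first exact: nearW.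
  have h : (fun n => f x - f_ n x) @ \oo --> (0 : R).
    by rewrite -(subrr (f x)); apply: cvgB; [exact: cvg_cst|exact: f_f].
  by have hh := cvgM h h; rewrite mulr0 in hh; exact: hh.
- apply/integrableP; split.
    by apply/measurable_EFinP; apply: measurable_funM => //; exact: measurable_funX.
  rewrite (eq_integral (fun x => 4%:E * (G x ^+ 2)%:E)%E); last first.
    by move=> x _; rewrite gee0_abs ?EFinM// -EFinM lee_fin mulr_ge0 ?sqr_ge0.
  rewrite ge0_integralZl//.
  + by rewrite lte_mul_pinfty.
  + by apply/measurable_EFinP; exact: measurable_funX.
  + by move=> x _; rewrite lee_fin sqr_ge0.
- apply: aeW => x n _; rewrite gee0_abs ?lee_fin ?sqr_ge0//.
  have := f_G n x; have := fG x; rewrite !ler_norml => /andP[? ?] /andP[? ?].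
  have : 0 <= (2 * G x - (f x - f_ n x)) * (2 * G x + (f x - f_ n x)).
    by rewrite mulr_ge0//; lra.
  by nra.
by move=> _ _; rewrite integral0.
Qed.

Lemma bounded_approximable_cvg f (f_ : nat -> T -> R) M :
  (forall n, approximable (f_ n)) ->
  (forall n x, `|f_ n x| <= M) ->
  (forall x, f_ ^~ x @ \oo --> f x) -> bounded_approximable f.
Proof.
move=> af_ f_M f_f; split.
  apply: (@approximable_cvg f f_ (cst M)) => //.
  rewrite (eq_integral (cst (M ^+ 2)%:E))// integral_cst// lte_mul_pinfty// ?lee_fin ?sqr_ge0//.
  by rewrite ltey_eq fin_num_measure.
exists M => x; have cn : (fun n => `|f_ n x|) @ \oo --> `|f x|.
  by apply: cvg_norm; exact: f_f.
rewrite -(cvg_lim _ cn)//; apply: limr_le; first by apply/cvg_ex; exists `|f x|.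
by apply: nearW => n; exact: f_M.
Qed.

End L2_closure.

(** * Polynomial approximation of the sign function *)

Section sign_iteration.
Context {R : realType}.

(* Iterating this polynomial on [-1, 1] converges to the sign, which puts the
   indicator of {f > 0} within reach of bounded pointwise limits of polynomials in f. *)
Definition sg_step (x : R) : R := x * (3 - x ^+ 2) / 2.

(** One step multiplies the defect 1 - u^2 by (1 - u^2)(4 - u^2)/4 <= 1 - u^2, and this is at most 1
    - x^2 because the iterates stay above x. The defect therefore decays geometrically. *)
Lemma iter_sg_step_bound n (x : R) : 0 < x <= 1 ->
  0 < iter n sg_step x <= 1 /\ 1 - iter n sg_step x ^+ 2 <= (1 - x ^+ 2) ^+ n.+1.
Proof.
move=> x01; have [x0 x1] := andP x01.
have c0 : 0 <= 1 - x ^+ 2 <= 1 by apply/andP; split; nra.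
(* The lower bound 0 is strengthened to x so that the induction can compare 1 - u^2 with 1 - x^2. *)
suff: x <= iter n sg_step x <= 1 /\ 1 - iter n sg_step x ^+ 2 <= (1 - x ^+ 2) ^+ n.+1.
  by move=> [/andP[xu u1] ?]; split => //; rewrite (lt_le_trans x0 xu).
elim: n => [|n [/andP[xu u1] ih]] /=; first by rewrite lexx x1 expr1.
move: (iter n sg_step x) xu u1 ih => u xu u1 ih.
have u0 : 0 < u by exact: lt_le_trans xu.
split.
  rewrite /sg_step; apply/andP; split; first by have : 0 <= u * (1 - u ^+ 2); nra.
  (* The image stays at most 1, as 1 - [sg_step] u = (1 - u)^2 (2 + u) / 2. *)
  have : 0 <= (1 - u) ^+ 2 * (2 + u) by rewrite mulr_ge0 ?sqr_ge0//; lra.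
  by nra.
have -> : 1 - sg_step u ^+ 2 = (1 - u ^+ 2) * ((1 - u ^+ 2) * (4 - u ^+ 2) / 4).
  by rewrite /sg_step; field.
rewrite [leRHS]exprSr; apply: ler_pM => //; [by nra| |].
  by rewrite !mulr_ge0//; nra.
have xu2 : x ^+ 2 <= u ^+ 2 by rewrite lerXn2r ?nnegrE// ltW.
have u2 : u ^+ 2 <= 1 by rewrite expr_le1// ltW.
have : 0 <= (1 - u ^+ 2) * u ^+ 2 by rewrite mulr_ge0 ?sqr_ge0 ?subr_ge0.
by nra.
Qed.

Lemma iter_sg_stepN n (x : R) : iter n sg_step (- x) = - iter n sg_step x.
Proof. by elim: n => //= n ->; rewrite /sg_step sqrrN !mulNr. Qed.

Lemma iter_sg_step_cvg (x : R) : `|x| <= 1 ->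
  (fun n => iter n sg_step x) @ \oo --> Num.sg x.
Proof.
suff pos (y : R) : 0 < y <= 1 -> (fun n => iter n sg_step y) @ \oo --> (1 : R).
  rewrite ler_norml => /andP[x1 x2]; have [x0|x0|->] := ltgtP x 0.
  - rewrite ltr0_sg//.
    have -> : (fun n => iter n sg_step x) = (fun n => - iter n sg_step (- x)).
      by apply/funext => n; rewrite iter_sg_stepN opprK.
    by apply: cvgN; apply: pos; apply/andP; split; lra.
  - by rewrite gtr0_sg//; apply: pos; rewrite x0.
  - rewrite sgr0 (_ : (fun _ => _) = cst 0); first exact: cvg_cst.
    by apply/funext => n; elim: n => //= n ->; rewrite /sg_step /= !mul0r.
move=> y01; have [y0 y1] := andP y01.
have lim1 : (fun n => 1 - (1 - y ^+ 2) ^+ n.+1) @ \oo --> (1 : R).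
  rewrite -[X in _ --> X]subr0; apply: cvgB; first exact: cvg_cst.
  have -> : (fun n => (1 - y ^+ 2) ^+ n.+1) = (fun n => (fun k => (1 - y ^+ 2) ^+ k) (n + 1)%N).
    by apply/funext => n; rewrite addn1.
  by rewrite cvg_shiftn; apply: cvg_expr; rewrite ltr_norml; apply/andP; split; nra.
apply: (squeeze_cvgr (h := cst 1) _ lim1); [apply: nearW => n /=|exact: cvg_cst].
(* For 0 < u <= 1 one has u >= u^2 >= 1 - (1 - y^2)^(n+1), the lower side of the squeeze. *)
have [/andP[u0 u1] ub] := iter_sg_step_bound n y01.
by rewrite u1 andbT; move: (_ ^+ n.+1) ub => ? ?; nra.
Qed.

End sign_iteration.

(** * The sigma-algebra of sets with approximable indicator *)

Section approximable_sets.
Context d (T : measurableType d) (R : realType).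
Context (mu : {finite_measure set T -> \bar R}) (P : set (T -> R)).
Hypothesis algP : bounded_algebra P.

Definition approximable_set (A : set T) :=
  measurable A /\ approximable mu P (\1_A : T -> R).

Lemma bounded_approximable_indic A : approximable_set A ->
  bounded_approximable mu P (\1_A : T -> R).
Proof.
move=> [mA aA]; split => //; exists 1 => x.
by rewrite indicE; case: (x \in A); rewrite ?normr1 ?normr0.
Qed.

Lemma approximable_ae_eq f g : measurable_fun setT g ->
  (\forall x \ae mu, f x = g x) -> approximable mu P f -> approximable mu P g.
Proof.
move=> mg fg [mf af]; split => // e /af[p Pp pe]; exists p => //.
have mp := algebra_measurable algP Pp.
rewrite (le_trans _ pe)// /sqdist le_eqVlt; apply/orP; left; apply/eqP.
apply: ae_eq_integral => //; try exact: measurable_sqB.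
by apply: filterS fg => x ->.
Qed.

Lemma approximable_setC A : approximable_set A -> approximable_set (~` A).
Proof.
move=> aA; have [mA _] := aA; split; first exact: measurableC.
have -> : \1_(~` A) = cst 1 \+ (fun x => (-1) * (\1_A x)) :> (T -> R).
  by apply/funext => x /=; rewrite !indicE in_setC; case: (x \in A) => /=; ring.
apply: (approximableD algP); first exact: (bounded_approximable_cst mu algP 1).1.
by apply: (approximableZ algP); exact: aA.2.
Qed.

Lemma approximable_setI A B : approximable_set A -> approximable_set B ->
  approximable_set (A `&` B).
Proof.
move=> aA aB; split; first by apply: measurableI; [exact: aA.1|exact: aB.1].
have -> : \1_(A `&` B) = \1_A \* \1_B :> (T -> R).
  by apply/funext => x /=; rewrite !indicE in_setI -natrM mulnb.
exact: (bounded_approximableM algP (bounded_approximable_indic aA)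
  (bounded_approximable_indic aB)).1.
Qed.

Lemma approximable_setU A B : approximable_set A -> approximable_set B ->
  approximable_set (A `|` B).
Proof.
move=> aA aB; rewrite -[A `|` B]setCK setCU.
by apply/approximable_setC/approximable_setI; exact: approximable_setC.
Qed.

Lemma approximable_set0 : approximable_set set0.
Proof.
split => //; rewrite indic0.
exact: (bounded_approximable_cst mu algP 0).1.
Qed.

(** At each point the indicators of the finite unions are eventually constant, so this is a bounded
    pointwise limit. *)
Lemma approximable_bigcup (F : (set T)^nat) :
  (forall n, approximable_set (F n)) -> approximable_set (\bigcup_n F n).
Proof.
move=> aF; split; first by apply: bigcup_measurable => n _; exact: (aF n).1.
pose G n := \big[setU/set0]_(i < n) F i.
have aG n : approximable_set (G n).
  rewrite /G; elim: n => [|n ih]; first by rewrite big_ord0; exact: approximable_set0.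
  by rewrite big_ord_recr; exact: approximable_setU.
apply: (bounded_approximable_cvg algP (f_ := fun n => \1_(G n)) (M := 1) _ _ _).1.
- by move=> n; exact: (aG n).2.
- by move=> n x; rewrite indicE; case: (x \in G n); rewrite ?normr1 ?normr0.
move=> x; apply: cvg_near_cst.
have [[N _ FNx]|nFx] := pselect ((\bigcup_n F n) x).
  exists N.+1 => // n Nn /=.
  have Gnx : G n x by rewrite /G -bigcup_mkord; exists N.
  by rewrite !indicE (mem_set Gnx) mem_set//; exists N.
apply: nearW => n /=; rewrite !indicE (memNset nFx) memNset// => Gnx; apply: nFx.
by move: Gnx; rewrite /G -bigcup_mkord => -[i _ Fix]; exists i.
Qed.

Lemma approximable_sigma_algebra : sigma_algebra setT approximable_set.
Proof.
split; [exact: approximable_set0| |exact: approximable_bigcup].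
by move=> A aA; rewrite setTD; exact: approximable_setC.
Qed.

(** Allows a half-space in one coordinate to be replaced by a set {f > 0} that agrees with it only
    in the interior of the cube. *)
Lemma approximable_set_ae A B : measurable B ->
  (\forall x \ae mu, A x <-> B x) -> approximable_set A -> approximable_set B.
Proof.
move=> mB AB [mA aA]; split => //; apply: approximable_ae_eq aA => //.
apply: filterS AB => x ABx; rewrite !indicE; congr (nat_of_bool _)%:R.
by apply/idP/idP; rewrite !inE; tauto.
Qed.

(** After f is scaled into [-1, 1], the iterates of [sg_step] are polynomials in f that converge
    boundedly to its sign. With t the sign, (t + t^2)/2 takes the values 1, 0, 0 at t = 1, 0, -1, so
    it is the indicator of {f > 0}. *)
Lemma approximable_set_gt0 f : bounded_approximable mu P f ->
  approximable_set [set x | 0 < f x].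
Proof.
move=> bf; have [[mf af] [M fM]] := bf.
split.
  have -> : [set x | 0 < f x] = setT `&` f @^-1` `]0, +oo[%classic.
    by rewrite setTI; apply/seteqP; split => x /=; rewrite in_itv/= andbT.
  by apply: mf => //; exact: measurable_itv.
(* M may be 0, or even negative if the space is empty; this divisor is always positive. *)
have N0 : 0 < `|M| + 1 by rewrite ltr_wpDl.
pose g x := (`|M| + 1)^-1 * f x.
have bg : bounded_approximable mu P g by exact: bounded_approximableZ.
have g1 x : `|g x| <= 1.
  rewrite normrM gtr0_norm ?invr_gt0// mulrC ler_pdivrMr// mul1r.
  by rewrite (le_trans (fM x))// (le_trans (ler_norm _))// lerDl.
have bi n : bounded_approximable mu P (fun x => iter n sg_step (g x)).
  elim: n => [//|n ih] /=.
  set h := fun x => iter n sg_step (g x) in ih *.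
  have -> : (fun x => sg_step (iter n sg_step (g x))) =
    (h \* (cst (3 / 2) \+ (fun x => (- (1 / 2)) * (h \* h) x))).
    by apply/funext => x /=; rewrite /sg_step /h; field.
  apply: (bounded_approximableM algP) => //.
  apply: (bounded_approximableD algP); first exact: bounded_approximable_cst.
  by apply: (bounded_approximableZ algP); exact: bounded_approximableM.
have bsg : bounded_approximable mu P (fun x => Num.sg (g x)).
  apply: (bounded_approximable_cvg algP
    (f_ := fun n x => iter n sg_step (g x)) (M := 1)).
  - by move=> n; exact: (bi n).1.
  - move=> n x; have := g1 x; rewrite ler_norml => /andP[x1 x2].
    have [x0|x0|->] := ltgtP (g x) 0.
    + have /(@iter_sg_step_bound R n)[/andP[u0 u1] _] : 0 < - g x <= 1.
        by apply/andP; split; lra.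
      by rewrite -[g x]opprK iter_sg_stepN normrN gtr0_norm.
    + have /(@iter_sg_step_bound R n)[/andP[u0 u1] _] : 0 < g x <= 1 by rewrite x0.
      by rewrite gtr0_norm.
    + suff -> : iter n sg_step (0 : R) = 0 by rewrite normr0.
      by elim: n => //= n ->; rewrite /sg_step !mul0r.
  - by move=> x; exact: iter_sg_step_cvg.
have -> : \1_[set x | 0 < f x] = (fun x => (1 / 2) *
   ((fun x => Num.sg (g x)) \+ (fun x => Num.sg (g x)) \* (fun x => Num.sg (g x))) x).
  apply/funext => x /=; rewrite indicE /g sgrM gtr0_sg ?invr_gt0// mul1r.
  have [x0|x0|x0] := ltgtP 0 (f x).
  - by rewrite mem_set//= gtr0_sg//; field.
  - by rewrite memNset ?ltr0_sg//=; [field|rewrite lt_gtF].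
  - by rewrite memNset /= -?x0 ?ltxx// sgr0; ring.
apply: (approximableZ algP); apply: (approximableD algP); first exact: bsg.1.
exact: (bounded_approximableM algP bsg bsg).1.
Qed.

(** * From measurable sets to square-integrable functions *)

Hypothesis setP : forall A, measurable A -> approximable_set A.

Import HBNNSimple.

Lemma approximable_nnsfun (f : {nnsfun T >-> R}) : approximable mu P f.
Proof.
have [r ->] : exists r : seq R,
    (f : T -> R) = (fun x => \sum_(y <- r) y * \1_(f @^-1` [set y]) x).
  eexists; apply/funext => x; rewrite fimfunE fsbig_finite; last exact: fimfunP.
  by [].
elim: r => [|y r ih].
  under eq_fun do rewrite big_nil.
  exact: (bounded_approximable_cst mu algP 0).1.
under eq_fun do rewrite big_cons.
apply: (approximableD algP) ih; apply: (approximableZ algP).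
exact: (setP (measurable_funPTI f (measurable_set1 y))).2.
Qed.

(** Simple functions increase to f, so f itself serves as the square-integrable majorant. *)
Lemma approximable_ge0 (f : T -> R) : measurable_fun setT f ->
  (forall x, 0 <= f x) ->
  (\int[mu]_x (f x ^+ 2)%:E < +oo)%E -> approximable mu P f.
Proof.
move=> mf f0 f2.
have mF : measurable_fun setT (EFin \o f) by exact/measurable_EFinP.
pose g := nnsfun_approx measurableT mF.
have gf x : (g ^~ x) @ \oo --> f x.
  have := cvg_nnsfun_approx measurableT mF (fun x _ => f0 x) (I : setT x).
  by move/fine_cvgP => [].
apply: (approximable_cvg algP (f_ := fun n => g n) mf f2) => //.
  by move=> n; exact: approximable_nnsfun.
move=> n x; rewrite ger0_norm//.
have ndg : nondecreasing_seq (g ^~ x).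
  by move=> a b ab; exact/lefP/nd_nnsfun_approx.
rewrite -(cvg_lim _ (gf x))//; apply: nondecreasing_cvgn_le => //.
by apply/cvg_ex; exists (f x).
Qed.

Lemma approximable_L2 (f : T -> R) : measurable_fun setT f ->
  (\int[mu]_x (f x ^+ 2)%:E < +oo)%E -> approximable mu P f.
Proof.
move=> mf f2.
have part (g : T -> R) : measurable_fun setT g -> (forall x, g x ^+ 2 <= f x ^+ 2) ->
   (\int[mu]_x (g x ^+ 2)%:E < +oo)%E.
  move=> mg gf; apply: le_lt_trans f2; apply: ge0_le_integral => //.
  - by move=> x _; rewrite lee_fin sqr_ge0.
  - by apply/measurable_EFinP; exact: measurable_funX.
  - by apply/measurable_EFinP; exact: measurable_funX.
  - by move=> x _; rewrite lee_fin.
have mp := measurable_funrpos mf; have mn := measurable_funrneg mf.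
rewrite [X in approximable _ _ X](_ : _ = f^\+ \+ (fun x => (-1) * f^\- x)); last first.
  apply/funext => x /=; rewrite /funrpos /funrneg mulN1r.
  by case: (leP (f x) 0) => ?; case: leP => ?; lra.
apply: (approximableD algP); last apply: (approximableZ algP).
- apply: approximable_ge0 => //; apply: part => // x; rewrite /funrpos.
  by case: (leP (f x) 0) => _ //; rewrite expr0n /= sqr_ge0.
- apply: approximable_ge0 => //; apply: part => // x; rewrite /funrneg.
  by case: (leP (- f x) 0) => _; rewrite ?sqrrN // expr0n /= sqr_ge0.
Qed.

End approximable_sets.

(** * Integrals over the torus *)

Lemma bounded_integrable d (T : measurableType d) (R : realType)
    (mu : {finite_measure set T -> \bar R}) (f : T -> R) (M : R) :
  measurable_fun setT f -> (forall x, `|f x| <= M) ->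
  mu.-integrable setT (EFin \o f).
Proof.
move=> mf fM; apply: measurable_bounded_integrable => //.
  by rewrite ltey_eq fin_num_measure.
exists M; split; first exact: num_real.
by move=> N MN x _ /=; rewrite (le_trans (fM x))// ltW.
Qed.

Section cons_measure_integral.
Context d (T : measurableType d) (R : realType) (n : nat).
Context (m : {finite_measure set T -> \bar R}).
Context (mu : {finite_measure set (n.-tuple T) -> \bar R}).

Let mcons : measurable_fun [set: T * n.-tuple T]
  (fun x : T * n.-tuple T => [tuple of x.1 :: x.2]).
Proof. exact: measurable_cons. Qed.

Lemma Rintegral_cons_measure (f : n.+1.-tuple T -> R) (M : R) :
  measurable_fun setT f -> (forall x, `|f x| <= M) ->
  \int[cons_measure m mu]_x f x =
  \int[m]_x \int[mu]_y f [tuple of x :: y].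
Proof.
move=> mf fM.
have mF : measurable_fun setT (EFin \o f) by exact/measurable_EFinP.
have prodfin : ((m \x mu)%E setT < +oo)%E.
  rewrite -setXTT product_measure1E// lte_mul_pinfty// ?fin_num_measure//.
  by rewrite ltey_eq fin_num_measure.
have iF : (m \x mu)%E.-integrable setT
    (EFin \o (fun x : T * n.-tuple T => f [tuple of x.1 :: x.2])).
  apply: measurable_bounded_integrable => //; first exact: measurableT_comp.
  exists M; split; first exact: num_real.
  by move=> N MN x _ /=; rewrite (le_trans (fM _))// ltW.
rewrite /Rintegral (_ : (\int[cons_measure m mu]_x (f x)%:E =
    \int[m \x mu]_x (f [tuple of x.1 :: x.2])%:E)%E); last first.
  exact: (integral_pushforward mcons mF iF measurableT).
rewrite -(integral12_prod_meas1 iF); congr fine.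
(* The iterated [Rintegral] applies [fine] to the inner integral, which loses nothing once that
   integral is known to be finite. *)
apply: eq_integral => x _; rewrite /fubini_F /= fineK//.
apply: integrable_fin_num => //.
apply: (@bounded_integrable _ _ _ mu _ M) => //.
by apply: measurableT_comp => //; apply: measurable_cons.
Qed.

Lemma cons_measure_head (B : set T) : measurable B -> m B = 0%E ->
  cons_measure m mu ((fun x => tnth x ord0) @^-1` B) = 0%E.
Proof.
move=> mB mB0.
rewrite /cons_measure /pushforward (_ : _ @^-1` _ = B `*` setT).
  by rewrite product_measure1E// [X in (X * _)%E]mB0 mul0e.
by apply/seteqP; split => -[x y] //= [].
Qed.

Lemma cons_measure_tail (i : 'I_n) (B : set T) : measurable B ->
  mu ((fun x => tnth x i) @^-1` B) = 0%E ->
  cons_measure m mu ((fun x => tnth x (lift ord0 i)) @^-1` B) = 0%E.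
Proof.
move=> mB mB0.
rewrite /cons_measure /pushforward
  (_ : _ @^-1` _ = setT `*` ((fun x => tnth x i) @^-1` B)).
  rewrite product_measure1E//; first by rewrite [X in (_ * X)%E]mB0 mule0.
  rewrite -[X in measurable X]setTI.
  exact: measurable_tnth.
by apply/seteqP; split => -[x y] /=; rewrite tnthS; [move=> ?; split|case].
Qed.

End cons_measure_integral.

Section torus_integrals.
Context {R : realType}.

Notation period_measure := (mfrestr (@measurable_period R) (@period_lty R)).

(** Serves to discard the faces of the cube. *)
Lemma torus_measure_coord0 d (i : 'I_d) (B : set (measurableTypeR R)) :
  measurable B -> period_measure B = 0%E ->
  torus_measure d ((fun x => tnth x i) @^-1` B) = 0%E.
Proof.
move=> mB mB0; elim: d i => [[]//|d ih] i.
have [->|[j ->]] : i = ord0 \/ exists j, i = lift ord0 j.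
  by case: (unliftP ord0 i) => [j ->|->]; [right; exists j|left].
  exact: cons_measure_head.
by apply: cons_measure_tail => //; exact: ih.
Qed.

Lemma period_pi_gt0 : 0 < 2 * pi :> R.
Proof. by rewrite mulr_gt0// pi_gt0. Qed.

(** The measure lives on the whole line: the complement of [period] is dropped as a null set, the
    rest is Lebesgue measure, and the fundamental theorem of calculus applies. *)
Lemma Rintegral_period (F f : R -> R) (M : R) : continuous f ->
  (forall x, `|f x| <= M) -> (forall x, is_derive x (1 : R) F (f x)) ->
  \int[period_measure]_x f x = F (2 * pi) - F 0.
Proof.
move=> cf fM dF.
have mf : measurable_fun setT f by exact: continuous_measurable_fun.
have cF : continuous F.
  by move=> x; apply: differentiable_continuous; apply/derivable1_diffP; exact: ex_derive.
have mp : measurable (period : set (measurableTypeR R)) by exact: measurable_period.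
have i_f : period_measure.-integrable setT (EFin \o f).
  exact: (@bounded_integrable _ _ _ _ _ M).
rewrite /Rintegral.
rewrite (negligible_integral (measurableC mp) measurableT i_f); last first.
  by rewrite /= /mfrestr /mrestr setICl measure0.
rewrite setDE setTI setCK.
rewrite (@eq_measure_integral _ _ _ _ (@lebesgue_measure R)); last first.
  by move=> A mA Ap; rewrite /= /mfrestr /mrestr setIidl.
rewrite (@continuous_FTC2 _ f F)//.
- exact: period_pi_gt0.
- exact: continuous_subspaceT.
- split.
  + by move=> x _; exact: ex_derive.
  + by apply: cvg_at_right_filter; exact: cF.
  + by apply: cvg_at_left_filter; exact: cF.
- by move=> x _; rewrite derive1E; exact: derive_val.
Qed.

Lemma trig_2pi (k : int) :
  sin (k%:~R * (2 * pi)) = 0 :> R /\ cos (k%:~R * (2 * pi)) = 1 :> R.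
Proof.
have nat_case n : sin (n%:R * (2 * pi)) = 0 :> R /\ cos (n%:R * (2 * pi)) = 1 :> R.
  have -> : n%:R * (2 * pi) = 0 + (pi *+ 2) *+ n :> R.
    by rewrite add0r -[RHS]mulr_natl -[pi *+ 2]mulr_natl.
  rewrite (periodicn (@sinD2pi R)) (periodicn (@cosD2pi R)).
  by rewrite sin0 cos0.
case: k => n; first exact: nat_case.
by rewrite NegzE mulrNz mulNr sinN cosN; have [-> ->] := nat_case n.+1; rewrite oppr0.
Qed.

Lemma Rintegral_period_trig (k : int) :
  \int[period_measure]_x cos (k%:~R * x) = (if k == 0 then 2 * pi else 0) /\
  \int[period_measure]_x sin (k%:~R * x) = 0.
Proof.
have ck : continuous (fun x : R => k%:~R * x) by move=> x; exact: mulrl_continuous.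
have ccos : continuous (fun x : R => cos (k%:~R * x)).
  by move=> x; apply: continuous_comp; [exact: ck|exact: continuous_cos].
have csin : continuous (fun x : R => sin (k%:~R * x)).
  by move=> x; apply: continuous_comp; [exact: ck|exact: continuous_sin].
have cosM (x : R) : `|cos (k%:~R * x)| <= 1 by exact: cos_max.
have sinM (x : R) : `|sin (k%:~R * x)| <= 1 by exact: sin_max.
have [k0|k0] := eqVneq k 0.
  have dcos (x : R) : is_derive x (1 : R) id (cos (k%:~R * x)).
    by rewrite k0 mul0r cos0; exact: is_derive_id.
  have dsin (x : R) : is_derive x (1 : R) (cst 0) (sin (k%:~R * x)).
    by rewrite k0 mul0r sin0; exact: is_derive_cst.
  by rewrite (Rintegral_period ccos cosM dcos) (Rintegral_period csin sinM dsin) !subr0.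
have kR : k%:~R != 0 :> R by rewrite intr_eq0.
have [s2 c2] := trig_2pi k.
have dcos (x : R) : is_derive x (1 : R) (fun y => k%:~R^-1 * sin (k%:~R * y)) (cos (k%:~R * x)).
  by apply: is_derive_eq; rewrite /GRing.scale /=; field.
have dsin (x : R) : is_derive x (1 : R) (fun y => - k%:~R^-1 * cos (k%:~R * y)) (sin (k%:~R * x)).
  by apply: is_derive_eq; rewrite /GRing.scale /=; field.
rewrite (Rintegral_period ccos cosM dcos) (Rintegral_period csin sinM dsin).
by rewrite s2 c2 !mulr0 sin0 cos0 mulr0 !subrr.
Qed.

End torus_integrals.

Section torus_trig.
Context {R : realType}.

Lemma kdot_cons d (a : int) (k : d.-tuple int) (x : measurableTypeR R) (y : d.-tuple (measurableTypeR R)) :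
  kdot [tuple of a :: k] [tuple of x :: y] = a%:~R * (x : R) + kdot k y.
Proof.
rewrite /kdot big_ord_recl !tnth0; congr (_ + _).
by apply: eq_bigr => j _; rewrite !tnthS.
Qed.

Lemma measurable_cos_kdot d (k : d.-tuple int) :
  measurable_fun setT (fun x => cos (@kdot R d k x)).
Proof.
apply: measurableT_comp; last exact: measurable_kdot.
by apply: continuous_measurable_fun; exact: continuous_cos.
Qed.

Lemma measurable_sin_kdot d (k : d.-tuple int) :
  measurable_fun setT (fun x => sin (@kdot R d k x)).
Proof.
apply: measurableT_comp; last exact: measurable_kdot.
by apply: continuous_measurable_fun; exact: continuous_sin.
Qed.

(** Induction on d by Fubini. Cosine and sine go together because the addition formulas mix them
    when the first coordinate is split off; k = 0 is tested by [all], which splits along with the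
    tuple. *)
Lemma Rintegral_torus_trig d (k : d.-tuple int) :
  \int[torus_measure d]_x cos (kdot k x) =
    (if all (pred1 0) k then (2 * pi) ^+ d else 0 : R) /\
  \int[torus_measure d]_x sin (kdot k x) = 0 :> R.
Proof.
elim: d k => [|d ih] k.
  rewrite tuple0 /= expr0 /Rintegral; split.
    rewrite integral_dirac//; last by apply/measurable_EFinP; exact: measurable_cos_kdot.
    by rewrite diracT mul1e /= /kdot big_ord0 cos0.
  rewrite integral_dirac//; last by apply/measurable_EFinP; exact: measurable_sin_kdot.
  by rewrite diracT mul1e /= /kdot big_ord0 sin0.
case/tupleP: k => a k; have [ihc ihs] := ih k.
have [ac as_] := @Rintegral_period_trig R a.
set m := mfrestr _ _ in ac as_ *.
have ic : (torus_measure d).-integrable setT (EFin \o (fun x => cos (@kdot R d k x))).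
  by apply: (@bounded_integrable _ _ _ _ _ 1); [exact: measurable_cos_kdot|move=> ?; exact: cos_max].
have is_ : (torus_measure d).-integrable setT (EFin \o (fun x => sin (@kdot R d k x))).
  by apply: (@bounded_integrable _ _ _ _ _ 1); [exact: measurable_sin_kdot|move=> ?; exact: sin_max].
have mM : measurable_fun setT (fun x : R => a%:~R * x) by exact: measurable_funM.
have iac : m.-integrable setT (EFin \o (fun x : R => cos (a%:~R * x))).
  apply: (@bounded_integrable _ _ _ _ _ 1) => [|?]; last exact: cos_max.
  by apply: measurableT_comp => //; apply: continuous_measurable_fun; exact: continuous_cos.
have ias : m.-integrable setT (EFin \o (fun x : R => sin (a%:~R * x))).
  apply: (@bounded_integrable _ _ _ _ _ 1) => [|?]; last exact: sin_max.
  by apply: measurableT_comp => //; apply: continuous_measurable_fun; exact: continuous_sin.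
(* u and v stand for the trigonometric factors in the first coordinate; the sine part vanishes by
   induction. *)
have inner (u v : R) :
    \int[torus_measure d]_y (u * cos (kdot k y) + v * sin (kdot k y)) =
    u * (if all (pred1 0) k then (2 * pi) ^+ d else 0).
  rewrite RintegralD//; first last.
  - exact: (integrableZl measurableT v is_).
  - exact: (integrableZl measurableT u ic).
  by rewrite !RintegralZl// ihc ihs mulr0 addr0.
split.
  rewrite (@Rintegral_cons_measure _ _ _ _ _ _ _ 1); first last.
  - by move=> x; exact: cos_max.
  - exact: measurable_cos_kdot.
  transitivity (\int[m]_x (cos (a%:~R * x) * (if all (pred1 0) k then (2 * pi) ^+ d else 0))).
    apply: eq_Rintegral => x _; rewrite -(inner _ (- sin (a%:~R * x))).
    by apply: eq_Rintegral => y _; rewrite kdot_cons cosD mulNr.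
  rewrite RintegralZr// ac /=; case: (a == 0) => /=; last by rewrite mul0r.
  by case: ifP; rewrite ?mulr0// exprS.
rewrite (@Rintegral_cons_measure _ _ _ _ _ _ _ 1); first last.
- by move=> x; exact: sin_max.
- exact: measurable_sin_kdot.
transitivity (\int[m]_x (sin (a%:~R * x) * (if all (pred1 0) k then (2 * pi) ^+ d else 0))).
  apply: eq_Rintegral => x _; rewrite -(inner _ (cos (a%:~R * x))).
  by apply: eq_Rintegral => y _; rewrite kdot_cons sinD.
by rewrite RintegralZr// as_ mul0r.
Qed.

End torus_trig.

(** * Trigonometric polynomials and the generators of the Borel sets *)

Section trig_polynomials.
Context {R : realType} {d : nat}.
Local Notation X := (d.-tuple (measurableTypeR R)).
Local Notation mu := (@torus_measure R d).

Lemma cisD (t u : R) : cis (t + u) = cis t * cis u.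
Proof.
by apply/eqP; rewrite eq_complex /= cosD sinD eqxx /=; apply/eqP; ring.
Qed.

(** Frequencies may repeat, so that a sum is a concatenation and a product a list of all pairs;
    repetitions are merged in [trig_sum_collect]. *)
Definition trig_sum (r : seq (d.-tuple int * R[i])) (x : X) : R[i] :=
  \sum_(ka <- r) ka.2 * cis (kdot ka.1 x).

Definition real_trig_poly : set (X -> R) :=
  [set p | exists r, forall x, (p x)%:C%C = trig_sum r x].

Definition tuple_add (k l : d.-tuple int) : d.-tuple int :=
  [tuple tnth k j + tnth l j | j < d].

Lemma kdot_add k l (x : X) : kdot (tuple_add k l) x = kdot k x + kdot l x.
Proof.
rewrite /kdot -big_split; apply: eq_bigr => j _ /=.
by rewrite tnth_mktuple rmorphD mulrDl.
Qed.

Lemma trig_sum_cat r r' x : trig_sum (r ++ r') x = trig_sum r x + trig_sum r' x.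
Proof. by rewrite /trig_sum big_cat. Qed.

Lemma trig_sum_mul r r' x :
  trig_sum [seq (tuple_add ka.1 lb.1, ka.2 * lb.2) | ka <- r, lb <- r'] x =
  trig_sum r x * trig_sum r' x.
Proof.
rewrite /trig_sum big_allpairs_dep mulr_suml; apply: eq_bigr => ka _.
rewrite mulr_sumr; apply: eq_bigr => lb _ /=.
by rewrite kdot_add cisD; ring.
Qed.

Lemma cmeasurable_cis_kdot (k : d.-tuple int) :
  cmeasurable (fun x : X => cis (kdot k x)).
Proof. by split => /=; [exact: measurable_cos_kdot|exact: measurable_sin_kdot]. Qed.

Lemma cmeasurable_trig_sum r : cmeasurable (trig_sum r).
Proof.
rewrite /trig_sum; elim: r => [|ka r ih].
  by under eq_fun do rewrite big_nil; split; exact: measurable_cst.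
under eq_fun do rewrite big_cons.
by apply: cmeasurable_axpy => //; exact: cmeasurable_cis_kdot.
Qed.

Lemma normc_trig_sum r x : normc (trig_sum r x) <= \sum_(ka <- r) normc ka.2.
Proof.
rewrite /trig_sum; elim: r => [|ka r ih]; first by rewrite !big_nil normc0.
rewrite !big_cons (le_trans (le_normcD _ _))// lerD//.
by rewrite normcM normc_cis mulr1.
Qed.

Lemma real_trig_poly_algebra : bounded_algebra real_trig_poly.
Proof.
split.
- move=> p [r pr]; rewrite (_ : p = fun x => Re (trig_sum r x)).
    by have [] := cmeasurable_trig_sum r.
  by apply/funext => x; rewrite -pr.
- move=> p [r pr]; exists (\sum_(ka <- r) normc ka.2) => x.
  rewrite (le_trans _ (normc_trig_sum r x))// -pr /=.
  by rewrite expr0n addr0 sqrtr_sqr.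
- move=> c; exists [:: ([tuple 0 | j < d], c%:C%C)] => x.
  rewrite /trig_sum big_seq1 /= /kdot big1 ?/cis ?cos0 ?sin0 ?mulr1//.
  by move=> j _; rewrite tnth_mktuple mulr0z mul0r.
- move=> p q [r pr] [r' qr']; exists (r ++ r') => x.
  by rewrite trig_sum_cat -pr -qr' /= -rmorphD.
- move=> p q [r pr] [r' qr'].
  exists [seq (tuple_add ka.1 lb.1, ka.2 * lb.2) | ka <- r, lb <- r'] => x.
  by rewrite trig_sum_mul -pr -qr' /= -rmorphM.
Qed.

Lemma real_trig_poly_cos (i : 'I_d) (b : R) :
  real_trig_poly (fun x => cos ((tnth x i : R) - b)).
Proof.
pose e (z : int) : d.-tuple int := [tuple if j == i then z else 0 | j < d].
have eE z (x : X) : kdot (e z) x = z%:~R * (tnth x i : R).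
  rewrite /kdot (bigD1 i)//= tnth_mktuple eqxx big1 ?addr0// => j /negPf ji.
  by rewrite tnth_mktuple ji mulr0z mul0r.
(* This is cos (x_i - b) = (e^(-ib) e^(i x_i) + e^(ib) e^(-i x_i)) / 2. *)
exists [:: (e 1, (cos b / 2 -i* (sin b / 2))%C); (e (-1), (cos b / 2 +i* (sin b / 2))%C)] => x.
rewrite /trig_sum !big_cons big_nil /= !eE mul1r mulN1r addr0.
by apply/eqP; rewrite eq_complex /= cosB cosN sinN; apply/andP; split; apply/eqP; field.
Qed.

Lemma torus_ae_coord (i : 'I_d) :
  \forall x \ae mu, 0 < (tnth x i : R) < 2 * pi.
Proof.
pose B : set (measurableTypeR R) := ~` `]0, 2 * pi[%classic.
have mB : measurable B by apply: measurableC; exact: measurable_itv.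
exists ((fun x : X => tnth x i) @^-1` B); split.
- by rewrite -[X in measurable X]setTI; exact: measurable_tnth.
- apply: torus_measure_coord0 => //.
  rewrite /mfrestr /mrestr; apply/eqP; rewrite eq_le measure_ge0 andbT.
  rewrite -(@countable_lebesgue_measure0 R [set 0; 2 * pi]); last first.
    by apply: finite_set_countable; exact: finite_set2.
  apply: le_measure; rewrite ?inE.
  + by apply: measurableI => //; exact: measurable_period.
  + by apply: measurableU; exact: measurable_set1.
  + move=> x [nx]; rewrite /period /= in_itv /= => /andP[x0 x2].
    have [->|x0'] := eqVneq x 0; first by left.
    have [->|x2'] := eqVneq x (2 * pi); first by right.
    exfalso; apply: nx; rewrite /= in_itv /=.
    by rewrite lt_neqAle eq_sym x0' x0 lt_neqAle x2' x2.
- by move=> x /= /negP nx; rewrite /B /= in_itv /=; exact/negP.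
Qed.

(** The difference equals 2 sin (y/2) sin ((a - y)/2). The first sine is positive, and (a - y)/2
    lies in (-pi, pi), so the second has the sign of a - y. *)
Lemma cosB_gt_cos (y a : R) : 0 < y < 2 * pi -> 0 < a < 2 * pi ->
  (0 < cos (y - a / 2) - cos (a / 2)) = (y < a).
Proof.
move=> /andP[y0 y2] /andP[a0 a2].
have -> : cos (y - a / 2) - cos (a / 2) = sin (y / 2) * (2 * sin ((a - y) / 2)).
  have -> : y - a / 2 = y / 2 - (a - y) / 2 by field.
  by rewrite [in cos (a / 2)](_ : a / 2 = y / 2 + (a - y) / 2) ?cosB ?cosD; [ring|field].
rewrite pmulr_rgt0; last by apply: sin_gt0_pi; apply/andP; split; lra.
rewrite pmulr_rgt0//; have [ya|ya] := ltP y a.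
  by apply: sin_gt0_pi; apply/andP; split; lra.
apply/negbTE; rewrite -leNgt.
have -> : (a - y) / 2 = - ((y - a) / 2) by field.
by rewrite sinN oppr_le0; apply: sin_ge0_pi; apply/andP; split; lra.
Qed.

Lemma approximable_coord_lt (i : 'I_d) (a : R) :
  approximable_set mu real_trig_poly [set x : X | (tnth x i : R) < a].
Proof.
have algP := real_trig_poly_algebra; have aei := torus_ae_coord i.
have mset : measurable [set x : X | (tnth x i : R) < a].
  rewrite (_ : [set _ | _] = setT `&` (fun x : X => tnth x i) @^-1` `]-oo, a[%classic); last first.
    by rewrite setTI; apply/seteqP; split => x /=; rewrite in_itv.
  by apply: measurable_tnth => //; exact: measurable_itv.
have aeF : Filter (almost_everywhere mu) by exact: ae_filter_ringOfSetsType.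
(* For a <= 0 the set is null and for a >= 2 pi it has full measure; only 0 < a < 2 pi needs the
   cosine. *)
have [a0|a0] := leP a 0.
  apply: (approximable_set_ae algP (A := set0)) => //; last exact: approximable_set0.
  by apply: filterS aei => x /andP[x0 _]; split => //= xa; move: x0; rewrite ltNge (le_trans (ltW xa)).
have [a2|a2] := leP (2 * pi) a.
  apply: (approximable_set_ae algP (A := ~` set0)) => //.
    by apply: filterS aei => x /andP[_ x2]; split => [_|_ []]; exact: lt_le_trans x2 a2.
  by apply: approximable_setC => //; exact: approximable_set0.
have a02 : 0 < a < 2 * pi by rewrite a0.
pose f (x : X) := cos ((tnth x i : R) - a / 2) - cos (a / 2).
apply: (approximable_set_ae algP (A := [set x | 0 < f x])) => //.
  by apply: filterS aei => x x02; rewrite /= /f cosB_gt_cos.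
apply: (approximable_set_gt0 algP).
rewrite (_ : f = (fun x => cos ((tnth x i : R) - a / 2)) \+ cst (- cos (a / 2)))//.
apply: (bounded_approximableD algP); last exact: bounded_approximable_cst.
by apply: (bounded_approximable_alg mu algP); exact: real_trig_poly_cos.
Qed.

Lemma approximable_measurable (A : set X) : measurable A ->
  approximable_set mu real_trig_poly A.
Proof.
have sigma := approximable_sigma_algebra mu real_trig_poly_algebra.
move: A; apply: smallest_sub => // B.
rewrite -bigcup_seq /= => -[i _ [C mC <-]].
(* The C whose preimage under the i-th coordinate is approximable form a sigma-algebra, so it is
   enough to check the rays below a, which generate the Borel sets. *)
have : (@RGenInftyO.G R).-sigma.-measurable C.
  by rewrite -RGenInftyO.measurableE.
have sigma' := sigma_algebra_image (fun x : X => tnth x i) sigma.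
move: C {mC}; apply: smallest_sub => // _ [a ->].
rewrite /image_set_system /= setTI (_ : _ @^-1` _ = [set x : X | (tnth x i : R) < a]).
  exact: approximable_coord_lt.
by apply/seteqP; split => x /=; rewrite in_itv.
Qed.

End trig_polynomials.

(** * Fourier series *)

Section fourier_series.
Context {R : realType} {d : nat}.
Local Notation X := (d.-tuple (measurableTypeR R)).
Local Notation mu := (@torus_measure R d).
Implicit Types (k l : d.-tuple int) (f g : L2fun mu).

Definition fourier_cst : R := (2 * pi) `^ (- (d%:R / 2)).

Lemma fourier_cst_gt0 : 0 < fourier_cst.
Proof. exact/powR_gt0/period_pi_gt0. Qed.

Lemma sqr_fourier_cst : fourier_cst ^+ 2 * (2 * pi) ^+ d = 1.
Proof.
have p0 := ltW (@period_pi_gt0 R).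
rewrite -powR_mulrn ?powR_ge0// -powRrM -powR_mulrn// -powRD; last first.
  by apply/implyP => _; rewrite gt_eqF// period_pi_gt0.
by rewrite (_ : _ + _ = 0) ?powRr0//; field.
Qed.

Definition exp_fun k (x : X) : R[i] := fourier_cst%:C%C * cis (kdot k x).

Lemma cmeasurable_exp_fun k : cmeasurable (exp_fun k).
Proof.
have m0 : cmeasurable (fun _ : X => 0 : R[i]) by split; exact: measurable_cst.
have := cmeasurable_axpy fourier_cst%:C%C (cmeasurable_cis_kdot k) m0.
by under eq_fun do rewrite addr0.
Qed.

Lemma normc_exp_fun k x : normc (exp_fun k x) = fourier_cst.
Proof.
rewrite normcM normc_cis mulr1 /= expr0n addr0 sqrtr_sqr gtr0_norm//.
exact: fourier_cst_gt0.
Qed.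

Lemma exp_fun_L2 k : exp_fun k \in L2_pred mu.
Proof.
apply/asboolP; split; first exact: cmeasurable_exp_fun.
rewrite /square_integrable (eq_integral (cst (fourier_cst ^+ 2)%:E)); last first.
  by move=> x _; rewrite normc_exp_fun.
rewrite integral_cst// lte_mul_pinfty// ?lee_fin ?sqr_ge0//.
by rewrite ltey_eq fin_num_measure.
Qed.

Definition exp_L2 k : L2fun mu := MkL2fun (exp_fun_L2 k).

Lemma Rintegral_torus1 : \int[mu]_x 1 = (2 * pi) ^+ d :> R.
Proof.
have [+ _] := @Rintegral_torus_trig R d [tuple 0 | j < d].
rewrite (_ : all _ _ = true); last by apply/allP => _ /mapP[j _ ->].
move=> <-; apply: eq_Rintegral => x _; rewrite /kdot big1 ?cos0// => j _.
by rewrite tnth_mktuple mulr0z mul0r.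
Qed.

(** Orthonormality of the exponentials: the product involved has frequency l - k. *)
Lemma coef_exp k l : fourier_coef_fun k (exp_L2 l) = (k == l)%:R.
Proof.
pose m : d.-tuple int := [tuple tnth l j - tnth k j | j < d].
have mE x : kdot l x - kdot k x = kdot m x :> R.
  rewrite /kdot -sumrB; apply: eq_bigr => j _.
  by rewrite tnth_mktuple rmorphB mulrBl.
have m0 : all (pred1 0) m = (k == l).
  apply/idP/eqP => [/allP m0|kl]; last first.
    by apply/allP => _ /mapP[j _ ->]; rewrite /= kl subrr.
  apply: eq_from_tnth => j; apply/esym/eqP.
  by have := m0 _ (mem_tnth j m); rewrite tnth_mktuple /= subr_eq0.
have [ic is_] := @Rintegral_torus_trig R d m.
have int_c : mu.-integrable setT (EFin \o (fun x => cos (@kdot R d m x))).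
  by apply: (@bounded_integrable _ _ _ _ _ 1); [exact: measurable_cos_kdot|move=> ?; exact: cos_max].
have int_s : mu.-integrable setT (EFin \o (fun x => sin (@kdot R d m x))).
  by apply: (@bounded_integrable _ _ _ _ _ 1); [exact: measurable_sin_kdot|move=> ?; exact: sin_max].
have prodE x : exp_fun l x * cis (- kdot k x) =
    ((fourier_cst * cos (kdot m x)) +i* (fourier_cst * sin (kdot m x)))%C.
  rewrite /exp_fun -mulrA -cisD mE; apply/eqP; rewrite eq_complex /=.
  by rewrite !mul0r subr0 addr0 !eqxx.
rewrite /fourier_coef_fun -/fourier_cst.
have -> : cintegral mu (fun x => exp_L2 l x * cis (- kdot k x)) =
    ((fourier_cst * \int[mu]_x cos (kdot m x)) +i*
     (fourier_cst * \int[mu]_x sin (kdot m x)))%C.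
  rewrite /cintegral; congr Complex; rewrite -RintegralZl//; apply: eq_Rintegral => x _.
    by rewrite prodE.
  by rewrite prodE.
rewrite ic is_ m0 mulr0; have := sqr_fourier_cst.
case: (k == l) => cE; last by rewrite mulr0 mulr0.
apply/eqP; rewrite eq_complex /= !mul0r subr0 addr0 mulr0 eqxx andbT.
by rewrite mulrA -expr2 cE.
Qed.

Lemma coefP (a : R[i]) k f g :
  fourier_coef_fun k (a *: f + g) =
  a * fourier_coef_fun k f + fourier_coef_fun k g.
Proof.
have := fourier_coef_is_linear k a (L2_class f) (L2_class g).
by rewrite -[a *: L2_class f]/(L2_scale _ _) pi_L2_scale pi_L2D !fourier_coefE.
Qed.

Definition sqnorm f : R := \int[mu]_x (normc (f x) ^+ 2).

Lemma integrable_sqnorm f : mu.-integrable setT (EFin \o (fun x => normc (f x) ^+ 2)).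
Proof.
have [mf f2] := L2funP f; apply/integrableP; split.
  exact/measurable_EFinP/cmeasurable_sqr_normc.
by under eq_integral do rewrite gee0_abs ?lee_fin ?sqr_ge0//.
Qed.

(** Completing the square in |f|^2 - 2 Re (conj(a) c) + |a|^2, where c is the k-th coefficient of
    f. *)
Lemma sqnorm_sub_exp (a : R[i]) k f :
  sqnorm (f - a *: exp_L2 k) = sqnorm f - normc (fourier_coef_fun k f) ^+ 2 +
    normc (fourier_coef_fun k f - a) ^+ 2.
Proof.
have [mf f2] := L2funP f.
have mfk := cmeasurable_mul_cis k mf; have f2k := square_integrable_mul_cis k f2.
have iR := integrable_Re mfk f2k; have iI := integrable_Im mfk f2k.
pose u x := Re (f x * cis (- kdot k x)); pose v x := Im (f x * cis (- kdot k x)).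
have int1 : mu.-integrable setT (EFin \o (fun _ => normc a ^+ 2 * fourier_cst ^+ 2 : R)).
  by apply: (@bounded_integrable _ _ _ _ _ `|normc a ^+ 2 * fourier_cst ^+ 2|).
have -> : sqnorm (f - a *: exp_L2 k) = \int[mu]_x
    ((- 2 * fourier_cst * Re a) * u x + (- 2 * fourier_cst * Im a) * v x +
     (normc (f x) ^+ 2 + normc a ^+ 2 * fourier_cst ^+ 2)).
  apply: eq_Rintegral => x _; rewrite -[(f - a *: exp_L2 k) x]/(f x - a * exp_fun k x).
  rewrite /u /v /exp_fun !sqr_normc_def.
  case: a {int1} => a1 a2; case: (f x) => f1 f2'.
  rewrite /= cosN sinN; have := cos2Dsin2 (kdot k x).
  move: (cos _) (sin _) => c s cs.
  (* Inserting cos^2 + sin^2 = 1 leaves a purely polynomial identity. *)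
  rewrite (_ : a1 ^+ 2 + a2 ^+ 2 = (a1 ^+ 2 + a2 ^+ 2) * (c ^+ 2 + s ^+ 2)); last by rewrite cs mulr1.
  ring.
rewrite Rintegral_lin2//; last exact: (integrableD measurableT (integrable_sqnorm f) int1).
rewrite RintegralD//; last exact: integrable_sqnorm.
rewrite -/(sqnorm f).
have -> : \int[mu]_x (normc a ^+ 2 * fourier_cst ^+ 2) = normc a ^+ 2.
  transitivity (\int[mu]_x (normc a ^+ 2 * fourier_cst ^+ 2 * 1)).
    by apply: eq_Rintegral => x _; rewrite mulr1.
  rewrite RintegralZl//; last by apply: (@bounded_integrable _ _ _ _ _ 1) => // ?; rewrite normr1.
  by rewrite Rintegral_torus1 -mulrA sqr_fourier_cst mulr1.
rewrite /fourier_coef_fun -/fourier_cst /cintegral.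
move: (\int[mu]_x Re _) (\int[mu]_x Im _) => A B.
by rewrite !sqr_normc_def; case: a {int1} => a1 a2 /=; ring.
Qed.

(** Frequencies are removed one at a time: by orthonormality, subtracting one term leaves the other
    coefficients of f unchanged. The last sum vanishes exactly when a agrees with the Fourier
    coefficients on F, so these give the best approximation. *)
Lemma sqnorm_sub_sum (a : d.-tuple int -> R[i]) (F : seq (d.-tuple int)) f : uniq F ->
  sqnorm (f - \sum_(k <- F) a k *: exp_L2 k) =
  sqnorm f - \sum_(k <- F) normc (fourier_coef_fun k f) ^+ 2 +
  \sum_(k <- F) normc (fourier_coef_fun k f - a k) ^+ 2.
Proof.
elim: F f => [|k F ih] f; first by rewrite !big_nil !subr0 addr0.
rewrite cons_uniq => /andP[kF uF]; rewrite !big_cons opprD addrA ih// sqnorm_sub_exp.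
have coefE l : l \in F ->
    fourier_coef_fun l (f - a k *: exp_L2 k) = fourier_coef_fun l f.
  move=> lF; rewrite addrC -scaleNr coefP coef_exp.
  have -> : (l == k) = false by apply: contraNF kF => /eqP <-.
  by rewrite mulr0 add0r.
have sumE (h : d.-tuple int -> R[i] -> R) :
    \sum_(l <- F) h l (fourier_coef_fun l (f - a k *: exp_L2 k)) =
    \sum_(l <- F) h l (fourier_coef_fun l f).
  by rewrite big_seq [RHS]big_seq; apply: eq_bigr => l lF; rewrite coefE.
rewrite (sumE (fun l z => normc z ^+ 2)) (sumE (fun l z => normc (z - a l) ^+ 2)).
ring.
Qed.

Lemma L2fun_sumE (a : d.-tuple int -> R[i]) (F : seq (d.-tuple int)) (x : X) :
  (\sum_(k <- F) a k *: exp_L2 k : L2fun mu) x = \sum_(k <- F) a k * exp_fun k x.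
Proof.
elim: F => [|k F ih]; first by rewrite !big_nil.
by rewrite !big_cons -ih.
Qed.

(** F may be larger than the set of frequencies of r, since the extra ones receive an empty sum. *)
Lemma trig_sum_collect (r : seq (d.-tuple int * R[i])) (F : seq (d.-tuple int)) (x : X) :
  uniq F -> {subset [seq ka.1 | ka <- r] <= F} ->
  trig_sum r x =
  \sum_(k <- F) ((\sum_(ka <- r | ka.1 == k) ka.2) / fourier_cst%:C%C) * exp_fun k x.
Proof.
move=> uF rF; have c0 : fourier_cst%:C%C != 0 :> R[i].
  by rewrite eq_complex /= eqxx andbT gt_eqF// fourier_cst_gt0.
transitivity (\sum_(k <- F) \sum_(ka <- r | ka.1 == k) ka.2 * cis (kdot k x)).
  rewrite (exchange_big_dep xpredT)//= /trig_sum.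
  rewrite big_seq [RHS]big_seq; apply: eq_bigr => ka kar.
  rewrite [RHS]big_mkcond (bigD1_seq ka.1)//=; last by apply: rF; exact: map_f.
  by rewrite eqxx big1 ?addr0// => k; rewrite eq_sym => /negPf ->.
by apply: eq_bigr => k _; rewrite /exp_fun mulrA divfK// mulr_suml.
Qed.

(** The bound is given for every finite G containing F because the comparison with a partial sum
    over L enlarges the frequency set to contain L as well. *)
Lemma trig_sum_dense f (e : R) : 0 < e ->
  exists (F : seq (d.-tuple int)) (a : d.-tuple int -> R[i]), forall G,
    uniq G -> {subset F <= G} -> sqnorm (f - \sum_(k <- G) a k *: exp_L2 k) <= e.
Proof.
move=> e0; have [[mR mI] f2] := L2funP f.
have part (h : X -> R) : measurable_fun setT h -> (forall x, h x ^+ 2 <= normc (f x) ^+ 2) ->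
    approximable mu real_trig_poly h.
  move=> mh hf; apply: approximable_L2 => //; [exact: real_trig_poly_algebra|exact: approximable_measurable|].
  apply: le_lt_trans f2; apply: ge0_le_integral => //.
  - by move=> x _; rewrite lee_fin sqr_ge0.
  - by apply/measurable_EFinP; exact: measurable_funX.
  - by apply/measurable_EFinP; exact: cmeasurable_sqr_normc.
  - by move=> x _; rewrite lee_fin.
have e2 : 0 < e / 2 by lra.
have [p [r pr] pe] : exists2 p, real_trig_poly p &
    (sqdist mu (fun x => Re (f x)) p <= (e / 2)%:E)%E.
  by apply: (part _ mR _).2 => // x; rewrite sqr_normc_def lerDl sqr_ge0.
have [q [r' qr] qe] : exists2 q, real_trig_poly q &
    (sqdist mu (fun x => Im (f x)) q <= (e / 2)%:E)%E.
  by apply: (part _ mI _).2 => // x; rewrite sqr_normc_def lerDr sqr_ge0.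
(* Real and imaginary parts, each approximated within e / 2, are recombined as p + i q. *)
pose z := r ++ [seq (ka.1, 'i%C * ka.2) | ka <- r'].
have zE x : trig_sum z x = (p x +i* q x)%C.
  rewrite trig_sum_cat -pr.
  have -> : trig_sum [seq (ka.1, 'i%C * ka.2) | ka <- r'] x = 'i%C * trig_sum r' x.
    by rewrite /trig_sum big_map mulr_sumr; apply: eq_bigr => ka _; rewrite mulrA.
  by rewrite -qr; apply/eqP; rewrite eq_complex /=; apply/andP; split; apply/eqP; ring.
exists [seq ka.1 | ka <- z].
exists (fun k => (\sum_(ka <- z | ka.1 == k) ka.2) / fourier_cst%:C%C) => G uG zG.
set S := \sum_(k <- G) _.
have fE x : normc ((f - S) x) ^+ 2 = (Re (f x) - p x) ^+ 2 + (Im (f x) - q x) ^+ 2.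
  rewrite -[(f - S) x]/(f x - S x) L2fun_sumE -trig_sum_collect// zE sqr_normc_def.
  by case: (f x).
have mp := algebra_measurable real_trig_poly_algebra (ex_intro _ r pr : real_trig_poly p).
have mq := algebra_measurable real_trig_poly_algebra (ex_intro _ r' qr : real_trig_poly q).
rewrite -lee_fin /sqnorm /Rintegral fineK; last first.
  by apply: integrable_fin_num => //; exact: integrable_sqnorm.
rewrite (eq_integral (fun x => ((Re (f x) - p x) ^+ 2)%:E + ((Im (f x) - q x) ^+ 2)%:E)%E); last first.
  by move=> x _; rewrite fE.
rewrite ge0_integralD//; first last.
- exact: measurable_sqB.
- by move=> x _; rewrite lee_fin sqr_ge0.
- exact: measurable_sqB.
- by move=> x _; rewrite lee_fin sqr_ge0.
by apply: le_trans (leeD pe qe) _; rewrite -EFinD lee_fin; lra.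
Qed.

(* The only consequence of density that the theorem needs. *)
Lemma sqnorm_sub_partial_le f (L : seq (d.-tuple int)) (B : R) : uniq L ->
  (forall G, uniq G -> {in G, forall k, k \notin L} ->
     \sum_(k <- G) normc (fourier_coef_fun k f) ^+ 2 <= B) ->
  sqnorm (f - \sum_(k <- L) fourier_coef_fun k f *: exp_L2 k) <= B.
Proof.
move=> uL LB; apply/ler_addgt0Pr => e e0.
have [F [a Fa]] := trig_sum_dense f e0.
(* G holds the frequencies of the approximant outside L. Over L ++ G the remainder |f|^2 - sum_L
   |c|^2 - sum_G |c|^2 is at most e, and the sum over G is at most B. *)
pose G := [seq k <- undup F | k \notin L].
have uG : uniq G by rewrite filter_uniq// undup_uniq.
have GL : {in G, forall k, k \notin L} by move=> k; rewrite mem_filter => /andP[].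
have uLG : uniq (L ++ G).
  rewrite cat_uniq uL uG andbT /=; apply/hasPn => k /GL; by [].
have FLG : {subset F <= L ++ G}.
  move=> k kF; rewrite mem_cat mem_filter mem_undup kF andbT.
  by case: (k \in L).
have := Fa _ uLG FLG; rewrite (sqnorm_sub_sum a f uLG).
have -> : \sum_(k <- L ++ G) normc (fourier_coef_fun k f) ^+ 2 =
    \sum_(k <- L) normc (fourier_coef_fun k f) ^+ 2 +
    \sum_(k <- G) normc (fourier_coef_fun k f) ^+ 2 by rewrite big_cat.
have := LB _ uG GL.
have : 0 <= \sum_(k <- L ++ G) normc (fourier_coef_fun k f - a k) ^+ 2.
  by apply: sumr_ge0 => k _; exact: sqr_ge0.
rewrite (sqnorm_sub_sum (fun k => fourier_coef_fun k f) f uL).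
rewrite [X in _ -> _ -> _ -> _ + X <= _]big1; last first.
  by move=> k _; rewrite subrr normc0 expr0n.
move: (\sum_(k <- L) _) (\sum_(k <- G) _) (\sum_(k <- _) _) (sqnorm f) => A1 A2 A3 A4.
lra.
Qed.

End fourier_series.

(** * Hyperbolic crosses *)

Section counting.
Context {R : realType}.

(** Each step adds both integers of the next modulus, which suits the induction on N in
    [sum_int_ball_le]. *)
Fixpoint int_ball (N : nat) : seq int :=
  if N is N'.+1 then N%:Z :: - N%:Z :: int_ball N' else [:: 0].

Lemma mem_int_ball (N : nat) (z : int) : (z \in int_ball N) = (`|z| <= N)%N.
Proof.
elim: N => [|N ih]; first by rewrite inE leqn0 absz_eq0.
rewrite !inE ih; lia.
Qed.

Lemma uniq_int_ball (N : nat) : uniq (int_ball N).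
Proof. elim: N => //= N ->; rewrite inE !mem_int_ball; lia. Qed.

Fixpoint int_box (N d : nat) : seq (d.-tuple int) :=
  if d is d'.+1 then [seq [tuple of z :: k] | z : int <- int_ball N, k : d'.-tuple int <- int_box N d']
  else [:: [tuple]].

Lemma uniq_int_box (N d : nat) : uniq (int_box N d).
Proof.
elim: d => //= d ih; apply: allpairs_uniq => //; first exact: uniq_int_ball.
move=> [z k] [z' k'] _ _ /= /(congr1 val) /= [-> kk'].
by congr (_, _); apply: val_inj.
Qed.

Lemma mem_int_box (N d : nat) (k : d.-tuple int) :
  (forall j, `|tnth k j| <= N)%N -> k \in int_box N d.
Proof.
elim: d k => [|d ih] k kN; first by rewrite tuple0 inE.
case/tupleP: k kN => z k kN; apply: (allpairs_f (fun (z : int) (k : d.-tuple int) => [tuple of z :: k])).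
  by rewrite mem_int_ball; have := kN ord0; rewrite tnth0.
by apply: ih => j; have := kN (lift ord0 j); rewrite tnthS.
Qed.

Lemma sum_int_box (g : int -> R) (N d : nat) :
  \sum_(k <- int_box N d) \prod_(j < d) g (tnth k j) =
  (\sum_(z <- int_ball N) g z) ^+ d.
Proof.
elim: d => [|d ih]; first by rewrite big_seq1 big_ord0 expr0.
rewrite exprS -ih big_allpairs_dep mulr_suml; apply: eq_bigr => z _.
rewrite mulr_sumr; apply: eq_bigr => k _.
rewrite big_ord_recl tnth0; congr (_ * _).
by apply: eq_bigr => j _; rewrite tnthS.
Qed.

(* Telescoping: [(m + 2)^-2 <= (m + 1)^-1 - (m + 2)^-1]. *)
Lemma sum_int_ball_le (q N : nat) :
  \sum_(z <- int_ball N) ((1 + `|z|%:~R)^-1 : R) ^+ q.+2 <=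
  1 + 2 * 2^-1 ^+ q * (1 - N.+1%:R^-1).
Proof.
elim: N => [|N ih].
  by rewrite big_seq1 normr0 mulr0z addr0 !invr1 expr1n subrr mulr0 addr0.
rewrite /= !big_cons normrN.
have -> : `|N.+1%:Z|%:~R = N.+1%:R :> R by [].
set S := \sum_(_ <- _) _ in ih *; set c := 2^-1 ^+ q in ih *.
set y : R := (1 + N.+1%:R)^-1.
have n0 : 0 < N.+1%:R :> R by rewrite ltr0n.
have yE : N.+2%:R^-1 = y :> R by rewrite /y -natr1 addrC.
have y0 : 0 < y by rewrite invr_gt0 addr_gt0.
have y2 : y <= 2^-1 by rewrite lef_pV2 ?posrE ?addr_gt0// -[2]/(1 + 1) lerD2l ler1n.
have tele : y ^+ 2 <= N.+1%:R^-1 - y.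
  have -> : N.+1%:R^-1 - y = N.+1%:R^-1 * y.
    by rewrite /y; field; rewrite !gt_eqF// addr_gt0.
  by rewrite expr2 ler_pM2r// lef_pV2 ?posrE ?addr_gt0// lerDr.
(* Of the q + 2 factors, q are bounded by 1/2 and the remaining two telescope. *)
have : y ^+ q.+2 <= c * (N.+1%:R^-1 - y).
  rewrite -addn2 exprD; apply: ler_pM => //.
  - by rewrite exprn_ge0// ltW.
  - by rewrite sqr_ge0.
  - by rewrite lerXn2r ?nnegrE ?invr_ge0// ltW.
rewrite ?yE; move: ih {y0 y2 tele yE}.
move: (y ^+ q.+2) (N.+1%:R^-1 : R) (c : R) (y : R) (S : R) => u v c' y' S'.
nra.
Qed.

(** In the exponent q + 2 the 2 gives convergence of the one-dimensional sum and q gives 2^-q <=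
    1/d, so that its d-th power is at most (1 + 2/d)^d <= e^2. The bound is uniform in N: the box
    only makes the set finite. *)
Lemma card_hyperbolic_cross (X : R) (N d : nat) : 1 <= X -> (0 < d)%N ->
  (size [seq k <- int_box N d | \prod_(j < d) (1 + `|tnth k j|%:~R) < X])%:R <=
  expR 2 * X ^+ (up_log 2 d).+2.
Proof.
move=> X1 d0; set q := up_log 2 d; have X0 : 0 < X by exact: lt_le_trans X1.
have pos (d' : nat) (k : d'.-tuple int) : 0 < \prod_(j < d') (1 + `|tnth k j|%:~R) :> R.
  by apply: prodr_gt0 => j _; rewrite ltr_pwDl// ler0z.
have dq : d%:R * 2^-1 ^+ q <= 1 :> R.
  rewrite exprVn ler_pdivrMr ?exprn_gt0// mul1r -natrX ler_nat.
  exact: up_logP.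
rewrite -sum1_size natr_sum big_filter.
(* A counted k contributes at least 1 to this sum, any other k at least 0. *)
apply: (@le_trans _ _ (\sum_(k <- int_box N d)
    X ^+ q.+2 * \prod_(j < d) (1 + `|tnth k j|%:~R)^-1 ^+ q.+2)).
  rewrite big_mkcond; apply: ler_sum => k _; case: ifP => kX.
    rewrite prodrXl prodfV -exprMn; apply: exprn_ege1.
    by rewrite ler_pdivlMr// mul1r ltW.
  apply: mulr_ge0; first by rewrite exprn_ge0// ltW.
  apply: prodr_ge0 => j _.
  by rewrite exprn_ge0// invr_ge0 addr_ge0// ler0z.
rewrite -mulr_sumr mulrC ler_wpM2r ?exprn_ge0 ?(ltW X0)//.
rewrite (sum_int_box (fun z => (1 + `|z|%:~R)^-1 ^+ q.+2)).
apply: (@le_trans _ _ (expR (2 / d%:R) ^+ d)); last first.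
  by rewrite -expRM_natl mulrC divfK// pnatr_eq0 -lt0n.
apply: lerXn2r; rewrite ?nnegrE ?expR_ge0//.
  by apply: sumr_ge0 => z _; rewrite exprn_ge0// invr_ge0 addr_ge0// ler0z.
apply: le_trans (sum_int_ball_le q N) _; apply: le_trans (expR_ge1Dx _).
rewrite lerD2l.
have c0 : 0 <= 2^-1 ^+ q :> R by rewrite exprn_ge0// invr_ge0.
have cd : 2^-1 ^+ q <= d%:R^-1 :> R.
  by rewrite -[leRHS]mul1r ler_pdivlMr ?ltr0n// mulrC.
have n0 : 0 <= N.+1%:R^-1 :> R by rewrite invr_ge0.
have cn : 0 <= 2^-1 ^+ q * N.+1%:R^-1 :> R by rewrite mulr_ge0.
by rewrite -mulrA ler_pM2l// (le_trans _ cd)// mulrBr mulr1 gerBl.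
Qed.

Lemma ln2_ge : 2^-1 <= ln 2 :> R.
Proof.
have h : -1 < - 2^-1 :> R by lra.
have := le_ln1Dx h; rewrite (_ : 1 + - 2^-1 = 2^-1 :> R); last by field.
by rewrite lnV ?posrE// lerN2.
Qed.

(** For d > 1, 2^([up_log] 2 d - 1) < d and ln 2 >= 1/2 give [up_log] 2 d <= 1 + 2 ln d. The case d
    = 1 is separate, as [up_log] is 0 there. *)
Lemma up_log2_le (d : nat) : (0 < d)%N -> (up_log 2 d).+2%:R <= 3 * (1 + ln d%:R) :> R.
Proof.
move=> d0; have ln0 : 0 <= ln d%:R :> R by rewrite ln_ge0// ler1n.
have [d1|d1] := leqP d 1.
  by have -> : d = 1%N by [lia]; rewrite up_log1 ln1; lra.
have q0 : (0 < up_log 2 d)%N by rewrite up_log_gt0.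
have := up_log_gtn (isT : 1 < 2)%N d1; move: q0.
case: (up_log 2 d) => //= q _ qd.
have : q%:R * ln 2 <= ln d%:R :> R.
  rewrite mulr_natl -lnXn// ler_ln ?posrE ?exprn_gt0 ?ltr0n//.
  by rewrite -natrX ler_nat ltnW.
have := ln2_ge; have : 0 <= q%:R :> R by [].
rewrite -[q.+3]addn3 natrD; nra.
Qed.

Lemma frequency_set (s eps : R) (d : nat) : 0 < s -> 0 < eps <= 1 -> (0 < d)%N ->
  exists L : seq (d.-tuple int), [/\ uniq L,
    forall k, k \notin L -> eps ^- 2 <= mix_weight s k &
    (size L)%:R <= expR 2 * expR (3 / s * ln eps^-1 * (1 + ln d%:R))].
Proof.
move=> s0 /andP[e0 e1] d0.
have lne0 : 0 <= ln eps^-1 by rewrite ln_ge0// invf_ge1.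
(* This is eps^(-1/s): the weight is the 2s-th power of the product, so it reaches eps^-2 when the
   product reaches X. *)
pose X := expR (s^-1 * ln eps^-1).
have X1 : 1 <= X by rewrite -expR0 ler_expR mulr_ge0// invr_ge0 ltW.
(* A single coordinate of modulus above N already makes the product at least X, so the box cuts off
   nothing of the cross. *)
pose N := `|Num.ceil X|%N.
exists [seq k <- int_box N d | \prod_(j < d) (1 + `|tnth k j|%:~R) < X].
split.
- by rewrite filter_uniq// uniq_int_box.
- move=> k; rewrite mem_filter negb_and -leNgt => kL.
  have Xk : X <= \prod_(j < d) (1 + `|tnth k j|%:~R).
    move: kL => /orP[//|kN].
    have [j jN] : exists j, (N < `|tnth k j|)%N.
      apply/existsP; apply: contraNT kN; rewrite negb_exists => /forallP kN.
      by apply: mem_int_box => j; rewrite leqNgt.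
    have XN : X <= N%:R.
      rewrite /N natr_absz ger0_norm; first exact: Num.Theory.ceil_ge.
      by rewrite -(ler_int R) (le_trans _ (Num.Theory.ceil_ge X))// (le_trans _ X1).
    rewrite (bigD1 j)//= -[leLHS]mulr1; apply: ler_pM => //.
    + by rewrite (le_trans _ X1).
    + rewrite (le_trans XN)// -natr_absz.
      by rewrite (_ : 1 + _ = (`|tnth k j|%N.+1)%:R) ?ler_nat ?leqW 1?ltnW// -natr1 addrC.
    + elim/big_ind: _ => // [x y|i _]; [exact: mulr_ege1|by rewrite lerDl ler0z].
  apply: (@le_trans _ _ (X `^ (2 * s))).
    rewrite -expRM (_ : s^-1 * ln eps^-1 * (2 * s) = 2 * ln eps^-1); last by field; rewrite gt_eqF.
    by rewrite expRM_natl lnK ?posrE ?invr_gt0// exprVn.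
  apply: le_trans (@ge0_ler_powR R (2 * s) _ _ _ _ _ Xk) _.
  + by rewrite mulr_ge0// ltW.
  + by rewrite nnegrE (le_trans _ X1).
  + by rewrite nnegrE (le_trans _ Xk)// (le_trans _ X1).
  suff [_ ->] : 0 <= \prod_(j < d) (1 + `|tnth k j|%:~R) :> R /\
      (\prod_(j < d) (1 + `|tnth k j|%:~R)) `^ (2 * s) = mix_weight s k by [].
  rewrite /mix_weight; elim/big_rec2: _ => [|j y x _ [x0 <-]]; first by rewrite powR1.
  have z0 : 0 <= 1 + `|tnth k j|%:~R :> R by rewrite addr_ge0// ler0z.
  by split; [exact: mulr_ge0|rewrite powRM].
- apply: le_trans (card_hyperbolic_cross N X1 d0) _.
  rewrite ler_pM2l ?expR_gt0// /X -expRM_natl ler_expR.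
  rewrite mulrC (_ : 3 / s * _ * _ = s^-1 * ln eps^-1 * (3 * (1 + ln d%:R))); last by ring.
  by rewrite ler_wpM2l ?up_log2_le// mulr_ge0// invr_ge0 ltW.
Qed.

End counting.

(** * Fourier partial sums as finite-rank operators *)

Section fourier_projection.
Context {R : realType} {d : nat}.
Local Notation mu := (@torus_measure R d).
Implicit Types (k : d.-tuple int) (L : seq (d.-tuple int)) (f g : L2space mu).

Lemma L2_class_sub (u v : L2fun mu) : L2_class (u - v) = L2_class u - L2_class v.
Proof. by apply: (addIr (L2_class v)); rewrite subrK pi_L2D subrK. Qed.

Lemma L2_class_lincomb (I : Type) (r : seq I) (a : I -> R[i]) (u : I -> L2fun mu) :
  \sum_(i <- r) a i *: L2_class (u i) = L2_class (\sum_(i <- r) a i *: u i).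
Proof.
elim: r => [|i r ih]; last by rewrite !big_cons ih -pi_L2D -pi_L2_scale.
by rewrite !big_nil -[in RHS](subrr 0) L2_class_sub subrr.
Qed.

Lemma fourier_coefD (a : R[i]) k f g :
  fourier_coef k (a *: f + g) = a * fourier_coef k f + fourier_coef k g.
Proof. exact: (fourier_coef_is_linear k a f g). Qed.

Lemma fourier_coef0 k : fourier_coef k (0 : L2space mu) = 0.
Proof. by have := fourier_coefD (-1) k 0 0; rewrite scaler0 addr0 mulN1r addNr. Qed.

Lemma fourier_coef_exp k l : fourier_coef k (L2_class (@exp_L2 R d l)) = (k == l)%:R.
Proof. by rewrite fourier_coefE coef_exp. Qed.

Lemma fourier_coef_lincomb k (I : Type) (r : seq I) (a : I -> R[i]) (u : I -> d.-tuple int) :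
  fourier_coef k (\sum_(i <- r) a i *: L2_class (@exp_L2 R d (u i))) =
  \sum_(i <- r) a i * (k == u i)%:R.
Proof.
elim: r => [|i r ih]; first by rewrite !big_nil fourier_coef0.
by rewrite !big_cons fourier_coefD ih fourier_coef_exp.
Qed.

Definition partial_sum L f : L2space mu :=
  \sum_(k <- L) fourier_coef k f *: L2_class (exp_L2 k).

Lemma partial_sum_is_linear L : linear (partial_sum L).
Proof.
move=> a f g; rewrite /partial_sum scaler_sumr -big_split; apply: eq_bigr => k _.
by rewrite fourier_coefD scalerDl scalerA.
Qed.

(** Parseval for a finite sum, obtained from [sqnorm_sub_sum] at the zero function with negated
    coefficients. *)
Lemma L2_norm_partial_sum L f : uniq L ->
  L2_norm (partial_sum L f) = Num.sqrt (\sum_(k <- L) normc (fourier_coef k f) ^+ 2).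
Proof.
move=> uL; rewrite /partial_sum L2_class_lincomb L2_normE; congr Num.sqrt.
have z0 : sqnorm (0 : L2fun mu) = 0.
  rewrite /sqnorm /Rintegral (eq_integral (cst 0%E)) ?integral0// => x _.
  by rewrite normc0 expr0n.
have c0 k : fourier_coef_fun k (0 : L2fun mu) = 0.
  by rewrite -fourier_coefE -[RHS](fourier_coef0 k) -(subrr 0) L2_class_sub subrr.
have := sqnorm_sub_sum (fun k => - fourier_coef k f) 0 uL.
rewrite z0 sub0r -sumrN [X in _ = 0 - X + _]big1 ?subr0 ?add0r => [H|k _]; last first.
  by rewrite c0 normc0 expr0n.
transitivity (sqnorm (\sum_(i <- L) - (- fourier_coef i f *: exp_L2 i))).
  by congr sqnorm; apply: eq_bigr => k _; rewrite scaleNr opprK.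
by rewrite H; apply: eq_bigr => k _; rewrite c0 sub0r opprK.
Qed.

Lemma L2_norm_sub_partial_sum_le L f (B : R) : uniq L ->
  (forall G, uniq G -> {in G, forall k, k \notin L} ->
     \sum_(k <- G) normc (fourier_coef k f) ^+ 2 <= B) ->
  L2_norm (f - partial_sum L f) <= Num.sqrt B.
Proof.
move=> uL LB; rewrite -{1}[f]L2_classK /partial_sum L2_class_lincomb -L2_class_sub L2_normE.
by apply: ler_wsqrtr; exact: sqnorm_sub_partial_le.
Qed.

Section hyperbolic.
Variable s : R.
Hypothesis s0 : 0 < s.
Local Notation Hm := (@Hmix R d s).

Lemma mix_weight_ge1 k : 1 <= mix_weight s k.
Proof.
rewrite /mix_weight; elim/big_ind: _ => // [x y|j _]; first exact: mulr_ege1.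
rewrite -[leLHS](powRr0 (1 + `|tnth k j|%:~R)); apply: ler_powR.
  by rewrite lerDl ler0z.
by rewrite mulr_ge0// ltW.
Qed.

Lemma Hmix_norm_sqr (f : Hm) : ((Hmix_norm f) ^+ 2)%:E = mix_sqr s (\val f).
Proof.
have m0 : (0 <= mix_sqr s (\val f))%E.
  by apply: esum_ge0 => k _; rewrite lee_fin mulr_ge0 ?sqr_ge0 ?mix_weight_ge0.
rewrite /Hmix_norm sqr_sqrtr ?fine_ge0// fineK// ge0_fin_numE//.
by have /asboolP := valP f.
Qed.

Lemma sum_coef_weight_le (f : Hm) (G : seq (d.-tuple int)) : uniq G ->
  \sum_(k <- G) normc (fourier_coef k (\val f)) ^+ 2 * mix_weight s k <=
  Hmix_norm f ^+ 2.
Proof.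
move=> uG; rewrite -lee_fin Hmix_norm_sqr; apply: esum_ge.
exists [set` G]; first by split; [exact: finite_seq|].
by rewrite -sumEFin fsbig_seq.
Qed.

(** [has_rank] asks for the exact range, so the spanning exponentials must lie in the domain of the
    projection. *)
Lemma exp_in_Hmix k : L2_class (@exp_L2 R d k) \in @Hmix_pred R d s.
Proof.
apply/asboolP; rewrite /mix_sqr.
have -> : \esum_(l in [set: d.-tuple int])
    (normc (fourier_coef l (L2_class (exp_L2 k))) ^+ 2 * mix_weight s l)%:E =
    \esum_(l in [set k]) (mix_weight s l)%:E.
  rewrite [RHS]esum_mkcond; apply: eq_esum => l _; rewrite fourier_coef_exp.
  case: (eqVneq l k) => [->|lk].
    by rewrite mem_set//= expr0n addr0 sqrtr_sqr normr1 expr1n mul1r.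
  by rewrite memNset ?normc0 ?expr0n ?mul0r// => /eqP; exact/negP.
rewrite esum_set1 ?ltry// lee_fin mix_weight_ge0//.
Qed.

Definition hyperbolic_projection L (f : Hm) : L2space mu :=
  partial_sum L (\val f).

Lemma hyperbolic_projection_is_linear L : linear (hyperbolic_projection L).
Proof. by move=> a f g; rewrite /hyperbolic_projection -partial_sum_is_linear. Qed.

HB.instance Definition _ L := GRing.isLinear.Build R[i] Hm (L2space mu) *:%R
  (hyperbolic_projection L) (hyperbolic_projection_is_linear L).

Lemma hyperbolic_projection_bounded L : uniq L ->
  bounded_operator (@Hmix_norm R d s) (@L2_norm _ _ R mu) (hyperbolic_projection L).
Proof.
move=> uL; exists 1 => f; rewrite mul1r L2_norm_partial_sum//.
have f0 : 0 <= Hmix_norm f by exact: sqrtr_ge0.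
rewrite -[leRHS](ger0_norm f0) -sqrtr_sqr; apply: ler_wsqrtr.
apply: le_trans (sum_coef_weight_le f uL); apply: ler_sum => k _.
by rewrite ler_peMr ?sqr_ge0// mix_weight_ge1.
Qed.

(** The coefficient functionals recover c from a combination of exponentials. This yields
    independence, and also shows that the projection fixes every such combination, so the range is
    the whole span. *)
Lemma hyperbolic_projection_rank L : uniq L ->
  has_rank (hyperbolic_projection L) (size L).
Proof.
move=> uL; pose t := in_tuple L.
have coefE (c : 'I_(size L) -> R[i]) i :
    fourier_coef (tnth t i) (\sum_(j < size L) c j *: L2_class (@exp_L2 R d (tnth t j))) = c i.
  rewrite fourier_coef_lincomb (bigD1 i)//= eqxx mulr1 big1 ?addr0// => j ji.
  suff /negPf -> : tnth t i != tnth t j by rewrite mulr0.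
  by apply: contraNneq ji => /(tuple_uniqP t uL) ->.
exists (fun i => L2_class (exp_L2 (tnth t i))); split.
  by move=> c c0 i; rewrite -(coefE c i) c0 fourier_coef0.
apply/seteqP; split => [_ [f _ <-]|y [c ->]].
  exists (fun i => fourier_coef (tnth t i) (\val f)).
  by rewrite /hyperbolic_projection /partial_sum (big_tnth _ _ L).
have fH : \sum_(i < size L) c i *: L2_class (exp_L2 (tnth t i)) \in @Hmix_pred R d s.
  by apply: rpred_sum => i _; apply: rpredZ; exact: exp_in_Hmix.
exists (MkHmix fH) => //.
rewrite /hyperbolic_projection /partial_sum (big_tnth _ _ L).
by apply: eq_bigr => i _; rewrite -[in RHS](coefE c i).
Qed.

(** The index is [(size L).+1] because the rank must be strictly smaller. Off L, |c_k|^2 <= B^2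
    |c_k|^2 w_k with w_k the weight, so on the unit ball the squared coefficients off L sum to at
    most B^2. *)
Lemma approximation_number_le L (B : R) : uniq L -> 0 < B ->
  (forall k, k \notin L -> B ^- 2 <= mix_weight s k) ->
  (approximation_number (@Hmix_norm R d s) (@L2_norm _ _ R mu) (size L).+1
     (@Hmix_embedding R d s) <= B%:E)%E.
Proof.
move=> uL B0 LB.
have opB : (operator_norm (@Hmix_norm R d s) (@L2_norm _ _ R mu)
   (fun f : Hm => @Hmix_embedding R d s f - hyperbolic_projection L f)%R <= B%:E)%E.
  apply: ub_ereal_sup => _ [f /= f1 <-]; rewrite lee_fin.
  rewrite -[B]gtr0_norm// -sqrtr_sqr; apply: L2_norm_sub_partial_sum_le => // G uG GL.
  have sumG := sum_coef_weight_le f uG.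
  apply: (@le_trans _ _ (B ^+ 2 * (Hmix_norm f ^+ 2))); last first.
    by rewrite ler_piMr ?sqr_ge0// expr_le1// sqrtr_ge0.
  apply: le_trans (ler_wpM2l (sqr_ge0 B) sumG).
  rewrite mulr_sumr big_seq [leRHS]big_seq; apply: ler_sum => k kG.
  rewrite mulrCA ler_peMr ?sqr_ge0//.
  have := LB k (GL k kG); rewrite -(ler_pM2l (exprn_gt0 2 B0)) divff//.
  by rewrite expf_neq0// gt_eqF.
apply: le_trans opB; apply: ereal_inf_lbound.
exists (hyperbolic_projection L) => //.
split; first exact: hyperbolic_projection_bounded.
by exists (size L) => //; exact: hyperbolic_projection_rank.
Qed.

End hyperbolic.

End fourier_projection.

(** * Choice of the tractability constants *)

Theorem theorem5p1 (R : realType) (s : R) (hs : 0 < s) :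
  quasi_polynomially_tractable (fun (eps : R) (d : nat) =>
    information_complexity (@Hmix_norm R d s) (@L2_norm _ _ R (torus_measure d))
      (@Hmix_embedding R d s) eps).
Proof.
(* The added 1 pays for n = size L + 1, since the exponential is at least 1 when eps <= 1; the 3
   comes from [up_log2_le]. *)
exists (3 / s), (expR 2 + 1); split; first by rewrite divr_gt0.
split; first by rewrite addr_gt0// expR_gt0.
move=> eps d e01 d0; have [e0 e1] := andP e01.
have [L [uL Lw sL]] := frequency_set hs e01 d0.
apply: (@le_trans _ _ ((size L).+1%:R)%:E).
  apply: ereal_inf_lbound; exists (size L).+1 => //; split => //.
  exact: approximation_number_le.
have x0 : 0 <= 3 / s * ln eps^-1 * (1 + ln d%:R).
  apply: mulr_ge0; last by rewrite addr_ge0// ln_ge0// ler1n.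
  by apply: mulr_ge0; rewrite ?ln_ge0 ?invf_ge1// divr_ge0// ltW.
have E1 : 1 <= expR (3 / s * ln eps^-1 * (1 + ln d%:R)) by rewrite -[leLHS]expR0 ler_expR.
rewrite lee_fin -natr1 mulrDl mul1r; exact: lerD.
Qed.
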